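(* There exists a constant $c>0$ such that, for all integers $r,d_1,D_2\ge0$ with $D_2\ge3$ and $\mathcal{P}(r,d_1,5,0,D_2)\neq\emptyset$, $$\mathbf{P}[P_{r,d_1,5,0,D_2}\text{ is connected}]>c.$$
   Context: $\mathcal{P}(n,d_1,d_2,D_1,D_2)$ denotes the set of simple labelled planar graphs on vertex set $\{1,\ldots,n\}$ whose minimum degree lies in $[d_1,d_2]$ and whose maximum degree lies in $[D_1,D_2]$; $P_{n,d_1,d_2,D_1,D_2}$ is a graph chosen uniformly at random from this set. In particular $\mathcal{P}(n,d_1,5,0,D_2)$ is the set of planar graphs on $\{1,\ldots,n\}$ all of whose degrees lie between $d_1$ and $D_2$. *)

(* Defs.v *)
From HB Require Import structures.
From mathcomp Require Import all_boot all_order all_algebra.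
From mathcomp Require Import all_classical all_reals all_analysis.

Set Implicit Arguments.
Unset Strict Implicit.
Unset Printing Implicit Defensive.

Import Order.TTheory GRing.Theory Num.Theory.
Import numFieldNormedType.Exports.

Local Open Scope classical_set_scope.
Local Open Scope ring_scope.

Section Graphs.
Variable V : finType.
Implicit Types (G : {set {set V}}) (u v : V).

(* A graph on V is given by its edge set. *)
Definition simple_graph G : bool := [forall e in G, #|e| == 2%N].

Definition adj G : rel V := fun u v => ([set u; v] \in G)%SET.

Definition degree G v : nat := #|adj G v|.

(* The default #|V| exceeds every degree of a simple graph, so it only matters
   when V is empty, where both degrees below are 0. *)
Definition min_degree G : nat := \big[minn/#|V|]_(v : V) degree G v.

Definition max_degree G : nat := (\max_(v : V) degree G v)%N.

Definition connected_graph G : bool :=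
  [forall u, forall v, connect (adj G) u v].

(* Crossing-free topological drawing in the plane R * R.  Only the values of
   arc e on [0, 1], for e an edge of G, are relevant. *)
Definition plane_drawing (R : realType) G
    (pt : V -> R * R) (arc : {set V} -> R -> R * R) : Prop :=
  [/\ injective pt,
      forall e, e \in G ->
        [/\ {within `[0, 1], continuous (arc e)},
            {in `[0, 1] &, injective (arc e)} &
            exists u v, [/\ e = [set u; v]%SET, arc e 0 = pt u & arc e 1 = pt v]],
      forall e, e \in G ->
        forall t, t \in `]0, 1[ -> forall v, arc e t <> pt v &
      forall e e', e \in G -> e' \in G -> e != e' ->
        forall t t', t \in `]0, 1[ -> t' \in `]0, 1[ -> arc e t <> arc e' t'].

Definition planar (R : realType) G : Prop :=
  exists (pt : V -> R * R) (arc : {set V} -> R -> R * R),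
    plane_drawing G pt arc.

End Graphs.

(* 'I_n = {0, ..., n-1} plays the role of the label set {1, ..., n}. *)
Definition planar_graphs (R : realType) (n d1 d2 D1 D2 : nat) :
    {set {set {set 'I_n}}} :=
  [set G : {set {set 'I_n}} |
     [&& simple_graph G, `[< planar R G >],
         (d1 <= min_degree G <= d2)%N & (D1 <= max_degree G <= D2)%N]]%SET.

Definition finite_uniform_pr (R : realType) (T : finType) (A : {set T})
    (E : pred T) : R :=
  #|[set x in A | E x]%SET|%:R / #|A|%:R.

(* Main.v *)
(* Let N_k be the number of graphs of the class with k components.  It suffices
   that k N_(k+1) <= M N_k for an absolute constant M, since then the class has
   at most e^M N_1 elements.  To merge two components, an edge xy of one of them
   and sometimes an edge uw of the other are deleted, and the edges ux and wy
   are added.  Every component contains a vertex u = w of degree at most 1, or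
   adjacent vertices u, w of degree 2, or, by looking at the end of a longest
   path, an edge uw that is a chord of a cycle up to a vertex of degree 2 on it.
   In the first two cases uw is kept, and the degrees of u and w grow to at most
   3 <= D2; in the last one uw is deleted and all degrees stay the same.

   There are about k (n + e) ways to do this in a graph with n vertices and e
   edges, and it can be undone in O(n + e) ways.  In the first two cases u, w, x
   and y are close to each other and pass through vertices of degree at most 3.
   In the last one the edge ux determines wy, provided that xy is not a bridge:
   wy is then the first bridge met on the way from u to x once ux is removed, or
   the second one if u has degree 2.  A component with too many bridges has many
   vertices of degree 1 or many pairs of adjacent vertices of degree 2, and these
   can be used with the roles of the two components exchanged.

   Planarity is preserved without any appeal to the Jordan curve theorem: an
   inversion opens a drawing up at an interior point of an edge into a half
   plane, on whose boundary the two halves of that edge end, so that two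
   components can be drawn in opposite half planes and joined in between. *)
Require Import Defs.
From mathcomp Require Import all_boot all_order all_algebra.
From mathcomp Require Import all_classical all_reals all_analysis.
From mathcomp Require Import ring lra zify.

Set Implicit Arguments.
Unset Strict Implicit.
Unset Printing Implicit Defensive.

Import Order.TTheory GRing.Theory Num.Theory.
Import numFieldNormedType.Exports.

Local Open Scope classical_set_scope.
Local Open Scope ring_scope.

(** * Plane drawings *)

Section Arcs.
Variable R : realType.
Local Notation plane := (R * R)%type.
Implicit Types (A B C : plane) (S : set plane).

(** The curve is continuous on the whole line, so that arcs compose without subspace topologies, but
    injective only on [0, 1]. [S] constrains interior points only, which lets arcs end at vertices
    or on the boundary of a region. *)
Definition jarc A B S : Prop := exists g : R -> plane,
  [/\ continuous g, {in `[0, 1] &, injective g}, g 0 = A, g 1 = B &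
      forall t, 0 < t < 1 -> S (g t)].

Lemma continuous_pair_for (T : topologicalType) (f h : T -> R) x :
  {for x, continuous f} -> {for x, continuous h} ->
  {for x, continuous (fun y => (f y, h y) : plane)}.
Proof. by move=> cf ch; apply: (cvg_pair cf ch). Qed.

Lemma continuous_affine (a b : R) : continuous (fun t : R => a * t + b).
Proof.
move=> t; apply: cvgD; last exact: cvg_cst.
by apply: cvgM; [exact: cvg_cst|exact: cvg_id].
Qed.

Lemma continuous_clamp (a b : R) :
  continuous (fun t : R => Num.max a (Num.min t b)).
Proof.
move=> t.
apply: (@continuous_max R R (fun=> a) (fun t => Num.min t b)).
  exact: cst_continuous.
apply: (@continuous_min R R id (fun=> b)); last exact: cst_continuous.
exact: cvg_id.
Qed.

Lemma clamp_id (a b t : R) : a <= t <= b -> Num.max a (Num.min t b) = t.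
Proof. by move=> /andP[at_ tb]; rewrite (min_idPl tb) (max_idPr at_). Qed.

(** Clamping the parameter retracts the line onto [0, 1]; this turns the arcs of [plane_drawing]
    into globally continuous ones. *)
Lemma within_clamp (T : topologicalType) (f : R -> T) :
  {within `[0, 1], continuous f} ->
  continuous (fun t : R => f (Num.max 0 (Num.min t 1))).
Proof.
move=> /subspace_continuousP fc t.
have tI : `[0 : R, 1]%classic (Num.max 0 (Num.min t 1)).
  by rewrite /= in_itv /= le_max lexx /= ge_max ler01 ge_min lexx orbT.
apply: (@cvg_comp _ _ _ (fun t : R => Num.max 0 (Num.min t 1)) f _
  (within `[0, 1] (nbhs (Num.max 0 (Num.min t 1)))) (nbhs (f (Num.max 0 (Num.min t 1))))); last exact: fc.
move=> U /= HU.
have H : \forall s \near t, `[0, 1]%classic (Num.max 0 (Num.min s 1)) ->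
    U (Num.max 0 (Num.min s 1)) by exact: (@continuous_clamp 0 1 t _ HU).
apply: filterS H => s; apply.
by rewrite /= in_itv /= le_max lexx /= ge_max ler01 ge_min lexx orbT.
Qed.

Lemma jarc_sub A B S S' : S `<=` S' -> jarc A B S -> jarc A B S'.
Proof. by move=> SS' [g [? ? ? ? gS]]; exists g; split=> // t /gS /SS'. Qed.

Lemma jarc_sym A B S : jarc A B S -> jarc B A S.
Proof.
move=> [g [gc gi g0 g1 gS]]; exists (fun t => g (- 1 * t + 1)); split.
- by move=> t; apply: continuous_comp; [exact: continuous_affine|exact: gc].
- move=> s t; rewrite !in_itv /= => sI tI /gi; rewrite !in_itv /=.
  move=> H; suff E : -1 * s + 1 = -1 * t + 1 by lra.
  by apply: H; lra.
- by rewrite mulr0 add0r.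
- by rewrite mulr1 addNr.
- by move=> t tI; apply: gS; lra.
Qed.

Lemma jarc_sub_arc (g : R -> plane) (a b : R) S :
  continuous g -> {in `[a, b] &, injective g} -> a < b ->
  (forall t, a < t < b -> S (g t)) -> jarc (g a) (g b) S.
Proof.
move=> gc gi ab gS; exists (fun t => g ((b - a) * t + a)).
have m (t : R) : 0 <= t <= 1 -> a <= (b - a) * t + a <= b by nra.
split.
- by move=> t; apply: continuous_comp; [exact: continuous_affine|exact: gc].
- move=> s t; rewrite !in_itv /= => sI tI /gi.
  rewrite !in_itv /= !m // => /(_ isT isT) /addIr /mulfI; apply.
  by rewrite subr_eq0 gt_eqF.
- by rewrite mulr0 add0r.
- by rewrite mulr1 subrK.
- by move=> t tI; apply: gS; nra.
Qed.

Lemma jarc_segment A B S : A <> B ->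
  (forall t, 0 < t < 1 ->
     S ((B.1 - A.1) * t + A.1, (B.2 - A.2) * t + A.2)) -> jarc A B S.
Proof.
case: A => a1 a2; case: B => b1 b2 /= AB HS.
exists (fun t => ((b1 - a1) * t + a1, (b2 - a2) * t + a2)); split.
- move=> t; apply: (@continuous_pair_for R (fun t => (b1 - a1) * t + a1)
    (fun t => (b2 - a2) * t + a2)); exact: continuous_affine.
- move=> s t _ _ [/addIr e1 /addIr e2]; apply/eqP; rewrite -subr_eq0.
  have [//|st] := boolP (s - t == 0); case: AB.
  have E (a b : R) : (b - a) * s = (b - a) * t -> a = b.
    move=> e; apply/eqP; rewrite eq_sym -subr_eq0.
    have : (b - a) * (s - t) == 0 by rewrite mulrBr e subrr.
    by rewrite mulf_eq0 (negbTE st) orbF.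
  by rewrite (E _ _ e1) (E _ _ e2).
- by rewrite !mulr0 !add0r.
- by rewrite !mulr1 !subrK.
- exact: HS.
Qed.

(** The clamp keeps the parameter in [0, 1], the only place where [g] is known to stay among the
    points at which [f] is continuous and injective. *)
Lemma jarc_map (f : plane -> plane) A B S :
  (forall z, (S z \/ z = A \/ z = B) -> {for z, continuous f}) ->
  (forall z z', (S z \/ z = A \/ z = B) -> (S z' \/ z' = A \/ z' = B) ->
     f z = f z' -> z = z') ->
  jarc A B S -> jarc (f A) (f B) (f @` S).
Proof.
move=> fc fi [g [gc gi g0 g1 gS]].
have gI (t : R) : 0 <= t <= 1 -> S (g t) \/ g t = A \/ g t = B.
  move=> tI; have [->|t0] := eqVneq t 0; first by right; left.
  have [->|t1] := eqVneq t 1; first by right; right.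
  by left; apply: gS; rewrite !lt_neqAle t1 eq_sym t0.
exists (fun t => f (g (Num.max 0 (Num.min t 1)))).
have clampI (t : R) : 0 <= Num.max 0 (Num.min t 1) <= 1.
  by rewrite le_max lexx /= ge_max ler01 ge_min lexx orbT.
split.
- move=> t; apply: (@continuous_comp _ _ _ (fun t : R => g (Num.max 0 (Num.min t 1))) f).
    apply: (@continuous_comp _ _ _ (fun t : R => Num.max 0 (Num.min t 1)) g).
      exact: continuous_clamp.
    exact: gc.
  exact/fc/gI.
- move=> s t; rewrite !in_itv /= => sI tI; rewrite !clamp_id // => /fi e.
  by apply: gi; rewrite ?in_itv //=; apply: e; exact: gI.
- by rewrite clamp_id ?g0 // lexx ler01.
- by rewrite clamp_id ?g1 // lexx ler01.
- move=> t tI; exists (g t); first exact: gS.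
  by rewrite clamp_id //; lra.
Qed.

Lemma jarc_cat A B C S1 S2 S :
  jarc A B S1 -> jarc B C S2 ->
  (forall z, (S1 z \/ z = A) -> (S2 z \/ z = C) -> False) ->
  S1 `<=` S -> S2 `<=` S -> S B -> jarc A C S.
Proof.
move=> [g [gc gi g0 g1 gS]] [h [hc hi h0 h1 hS]] dis S1S S2S SB.
(* On each half one of the two clamped terms is constantly [B] and cancels, so the concatenation is
   continuous as a sum and needs no gluing at 1/2. *)
pose f (t : R) := g (Num.max 0 (Num.min (2 * t) 1)) +
                  h (Num.max 0 (Num.min (2 * t - 1) 1)) - B.
have fl (t : R) : 0 <= t <= 1 / 2 -> f t = g (2 * t).
  move=> tI; rewrite /f clamp_id; last lra.
  have -> : Num.max 0 (Num.min (2 * t - 1) 1) = 0.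
    by apply/max_idPl; rewrite ge_min; apply/orP; left; lra.
  by rewrite h0 addrK.
have fr (t : R) : 1 / 2 <= t <= 1 -> f t = h (2 * t - 1).
  move=> tI; rewrite /f.
  have -> : Num.max 0 (Num.min (2 * t - 1) 1) = 2 * t - 1.
    by apply: clamp_id; lra.
  have -> : Num.max 0 (Num.min (2 * t) 1) = 1.
    have -> : Num.min (2 * t) 1 = 1 by apply/min_idPr; lra.
    by apply/max_idPr; exact: ler01.
  by rewrite g1 addrAC subrr add0r.
have gA (t : R) : 0 <= t < 1 -> S1 (g t) \/ g t = A.
  move=> tI; have [->|t0] := eqVneq t 0; first by right.
  have t0' : 0 < t by rewrite lt_neqAle eq_sym t0; lra.
  by left; apply: gS; lra.
have hC (t : R) : 0 < t <= 1 -> S2 (h t) \/ h t = C.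
  move=> tI; have [->|t0] := eqVneq t 1; first by right.
  have t0' : t < 1 by rewrite lt_neqAle t0; lra.
  by left; apply: hS; lra.
exists f; split.
- move=> t; apply: cvgB; last exact: cvg_cst.
  apply: cvgD.
    apply: (@continuous_comp _ _ _ (fun t : R => Num.max 0 (Num.min (2 * t) 1)) g); last exact: gc.
    apply: (@continuous_comp _ _ _ (fun t : R => 2 * t) (fun t : R => Num.max 0 (Num.min t 1))).
      by have := @continuous_affine 2 0 t; under eq_fun do rewrite addr0.
    exact: continuous_clamp.
  apply: (@continuous_comp _ _ _ (fun t : R => Num.max 0 (Num.min (2 * t - 1) 1)) h); last exact: hc.
  apply: (@continuous_comp _ _ _ (fun t : R => 2 * t - 1) (fun t : R => Num.max 0 (Num.min t 1))).
    exact: continuous_affine.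
  exact: continuous_clamp.
- have key (s t : R) : 0 <= s <= 1 / 2 -> 1 / 2 < t <= 1 -> f s = f t -> False.
    move=> sI tI; rewrite fl // fr; last lra.
    have tC : S2 (h (2 * t - 1)) \/ h (2 * t - 1) = C by apply: hC; lra.
    have [s2|s2] := eqVneq s (1 / 2).
      have -> : 2 * s = 1 by lra.
      rewrite g1 -h0 => /hi; rewrite !in_itv /= => H.
      suff E : (0 : R) = 2 * t - 1 by (suff : t < t by rewrite ltxx); lra.
      by apply: H; lra.
    move=> e; apply: (dis (g (2 * s))); last by rewrite e.
    have s3 : s < 1 / 2 by rewrite lt_neqAle s2; lra.
    by apply: gA; lra.
  move=> s t; rewrite !in_itv /= => sI tI e.
  have [s2|s2] := lerP s (1 / 2); have [t2|t2] := lerP t (1 / 2).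
  + move: e; rewrite !fl; [|lra|lra] => /gi; rewrite !in_itv /= => H.
    suff E : 2 * s = 2 * t by lra.
    by apply: H; lra.
  + by case: (@key s t) => //; lra.
  + by case: (@key t s) => //; lra.
  + move: e; rewrite !fr; [|lra|lra] => /hi; rewrite !in_itv /= => H.
    suff E : 2 * s - 1 = 2 * t - 1 by lra.
    by apply: H; lra.
- by rewrite fl ?mulr0 //; lra.
- rewrite fr; last lra.
  have -> : 2 * 1 - 1 = 1 :> R by lra.
  exact: h1.
- move=> t tI; have [t2|t2|t2] := ltgtP t (1 / 2).
  + by rewrite fl; [apply/S1S/gS; lra|lra].
  + by rewrite fr; [apply/S2S/hS; lra|lra].
  + rewrite fl; last lra.
    have -> : 2 * t = 1 :> R by lra.
    by rewrite g1.

Qed.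

End Arcs.

(** Gives one clearance for all vertices or all edges of a drawing: the least of finitely many
    individual bounds. *)
Lemma finite_pos_bound (R : realType) (T : finType) (P : T -> R -> Prop) :
  (forall x, exists2 d, 0 < d & P x d) ->
  (forall x d d', 0 < d' <= d -> P x d -> P x d') ->
  exists2 d, 0 < d & forall x, P x d.
Proof.
move=> exP mono.
have /choice[f fP] : forall x, exists d, 0 < d /\ P x d.
  by move=> x; have [d d0 Pd] := exP x; exists d.
suff [d d0 dle] : exists2 d, 0 < d & forall x, x \in enum T -> d <= f x.
  exists d => // x; have [fx0 Px] := fP x.
  by apply: mono Px; rewrite d0 dle // mem_enum.
elim: (enum T) => [|x s [d d0 IH]]; first by exists 1.
exists (Num.min d (f x)); first by rewrite lt_min d0 (fP x).1.
move=> y; rewrite inE => /predU1P[->|/IH ds]; first by rewrite ge_min lexx orbT.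
by rewrite ge_min ds.
Qed.

(** * Clearance and hitting times *)

Section Hit.
Variable R : realType.
Local Notation plane := (R * R)%type.

Definition dsq (z p : plane) : R := (z.1 - p.1) ^+ 2 + (z.2 - p.2) ^+ 2.

Lemma dsq_eq0 z p : dsq z p = 0 -> z = p.
Proof.
case: z p => a b [c d] /eqP; rewrite /dsq /= paddr_eq0 ?sqr_ge0 //.
by rewrite !sqrf_eq0 !subr_eq0 => /andP[/eqP-> /eqP->].
Qed.

Lemma dsq_ge0 z p : 0 <= dsq z p.
Proof. by rewrite addr_ge0 // sqr_ge0. Qed.

Lemma dsqxx z : dsq z z = 0.
Proof. by rewrite /dsq !subrr expr0n addr0. Qed.

Lemma continuous_dsq p : continuous (fun z => dsq z p).
Proof.
move=> z; rewrite /dsq; under eq_fun do rewrite !expr2.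
have c1 : (fun z : plane => z.1 - p.1) @ z --> z.1 - p.1.
  by apply: cvgB; [exact: cvg_fst|exact: cvg_cst].
have c2 : (fun z : plane => z.2 - p.2) @ z --> z.2 - p.2.
  by apply: cvgB; [exact: cvg_snd|exact: cvg_cst].
by apply: cvgD; apply: cvgM.
Qed.

(** The hitting time is the least element of the compact set of t in [0, b] with [h t <= r]; a value
    below [r] there would, by the intermediate value theorem, give an earlier hit. *)
Lemma first_hit (h : R -> R) (b r : R) : continuous h -> 0 < b ->
  r < h 0 -> h b < r ->
  exists t0, [/\ 0 < t0 < b, h t0 = r & forall s, 0 <= s < t0 -> r < h s].
Proof.
move=> hc b0 h0 hb.
pose A : set R := `[0, b]%classic `&` h @^-1` [set x | x <= r].
have Ac : compact A.
  apply: (subclosed_compact _ (@segment_compact _ 0 b)); last by move=> t [].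
  apply: closedI; first exact: interval_closed.
  by apply: closed_comp; [move=> t _; exact: hc|exact: closed_le].
have A0 : A !=set0 by exists b; split; rewrite /= ?in_itv /= ?lexx ?ltW.
have [|t0 /set_mem[]] := compact_EVT_min A0 Ac (f := id).
  by apply: continuous_subspaceT => t; exact: cvg_id.
rewrite /= in_itv /= => t0I ht0 tmin.
have sP s : 0 <= s < t0 -> r < h s.
  move=> sI; rewrite ltNge; apply/negP => hs.
  suff /tmin : s \in A by lra.
  by apply/mem_set; split=> //=; rewrite in_itv /=; lra.
have t00 : 0 < t0.
  rewrite lt_neqAle; apply/andP; split; last by case/andP: t0I.
  by apply/eqP => e; move: ht0; rewrite -e; lra.
have hr : h t0 = r.
  apply/eqP; rewrite eq_le ht0 /= leNgt; apply/negP => hlt.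
  have [||s] := @IVT R h 0 t0 r (ltW t00).
  - exact: continuous_subspaceT.
  - by rewrite ge_min le_max (ltW h0) (ltW hlt) orbT.
  rewrite in_itv /= => sI hs.
  have [st|st] := ltP s t0; first by move: (sP s); rewrite hs ltxx; lra.
  have e : s = t0 by lra.
  by move: hlt; rewrite -e hs ltxx.
exists t0; split=> //; rewrite t00 /= lt_neqAle; apply/andP; split; last lra.
by apply/eqP => e; move: hb; rewrite -e hr ltxx.
Qed.

Lemma last_hit (h : R -> R) (b r : R) : continuous h -> b < 1 ->
  r < h 1 -> h b < r ->
  exists t1, [/\ b < t1 < 1, h t1 = r & forall s, t1 < s <= 1 -> r < h s].
Proof.
move=> hc b1 h1 hb.
have [||||t [tI ht tP]] := @first_hit (fun t => h (- 1 * t + 1)) (1 - b) r.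
- move=> t; apply: (@continuous_comp _ _ _ (fun t : R => -1 * t + 1) h).
    exact: continuous_affine.
  exact: hc.
- by lra.
- by rewrite mulr0 add0r.
- by have -> : -1 * (1 - b) + 1 = b by lra.
exists (- 1 * t + 1); split=> //; first lra.
move=> s sI; have -> : s = -1 * (1 - s) + 1 by lra.
by apply: tP; lra.
Qed.

(** The squared distance to [p] attains its minimum along the arc, and this is positive because [p]
    is not on the closed arc. *)
Lemma jarc_avoid (A B p : plane) (S : set plane) :
  jarc A B S -> ~ S p -> p <> A -> p <> B ->
  exists2 d, 0 < d &
    [/\ jarc A B (S `&` [set z | d <= dsq z p]), d <= dsq A p & d <= dsq B p].
Proof.
move=> [g [gc gi g0 g1 gS]] Sp pA pB.
have hc : continuous (fun t => dsq (g t) p).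
  move=> t; apply: (@continuous_comp _ _ _ g (fun z => dsq z p)).
    exact: gc.
  exact: continuous_dsq.
have [|c cI cmin] := @EVT_min R (fun t => dsq (g t) p) 0 1 ler01.
  exact: continuous_subspaceT.
exists (dsq (g c) p).
  rewrite lt_neqAle dsq_ge0 andbT eq_sym; apply/eqP => /dsq_eq0 e.
  move: cI; rewrite in_itv /= => cI.
  have [c0|c0] := eqVneq c 0; first by apply: pA; rewrite -g0 -c0.
  have [c1|c1] := eqVneq c 1; first by apply: pB; rewrite -g1 -c1.
  apply: Sp; rewrite -e; apply: gS.
  by rewrite !lt_neqAle c1 eq_sym c0.
have H t : 0 <= t <= 1 -> dsq (g c) p <= dsq (g t) p.
  by move=> tI; apply: cmin; rewrite in_itv.
split; last 2 first.
- by rewrite -g0; apply: H; lra.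
- by rewrite -g1; apply: H; lra.
exists g; split=> // t tI; split; first exact: gS.
by apply: H; lra.
Qed.

End Hit.

(** * Drawings as colourings of the plane *)

Section Colouring.
Variables (R : realType) (V : finType).
Local Notation plane := (R * R)%type.
Implicit Types (G : {set {set V}}) (c : plane -> option (V + {set V} + bool)).

(* Describing a drawing by a colouring of the plane makes its disjointness
   conditions automatic.  The labels [Wh] are for the halves of an opened edge. *)
Definition colour := option (V + {set V} + bool).
Definition Vx (v : V) : colour := Some (inl (inl v)).
Definition Ed (e : {set V}) : colour := Some (inl (inr e)).
Definition Wh (b : bool) : colour := Some (inr b).

(** Lets a colouring be specified piece by piece: the only obligation is that pieces with different
    labels are disjoint, and a point of no piece gets [None]. *)
Lemma colour_of_rel (P : plane -> colour -> Prop) :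
  (forall z l l', P z l -> P z l' -> l = l') ->
  exists c : plane -> colour, forall z l, P z l -> c z = l.
Proof.
move=> Puniq.
have /choice[c cP] : forall z, exists l, forall l', P z l' -> l = l'.
  move=> z; have [[l Pl]|nP] := pselect (exists l, P z l).
    by exists l => l' Pl'; exact: Puniq Pl Pl'.
  by exists None => l' Pl'; case: nP; exists l'.
by exists c => z l /cP.
Qed.

Definition coloured G (pt : V -> plane) (c : plane -> colour) : Prop :=
  (forall v, c (pt v) = Vx v) /\
  forall e, e \in G -> exists a b,
    e = [set a; b]%SET /\ jarc (pt a) (pt b) [set z | c z = Ed e].

Lemma planar_coloured G : planar R G -> exists pt c, coloured G pt c.
Proof.
move=> [pt [arc [pti arcP arcpt arcarc]]]; exists pt.
pose P z l := (exists v, z = pt v /\ l = Vx v) \/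
  (exists e, [/\ e \in G, exists2 t, t \in `]0, 1[ & z = arc e t & l = Ed e]).
have [|c cP] := @colour_of_rel P.
  move=> z l l' [[v [-> ->]]|[e [eG [t tI ->] ->]]];
    move=> [[v' [e1 ->]]|[e' [e'G [t' t'I e1] ->]]].
  - by rewrite (pti _ _ e1).
  - by case: (arcpt e' e'G t' t'I v).
  - by case: (arcpt e eG t tI v').
  - have [-> //|ee'] := eqVneq e e'.
    by case: (arcarc e e' eG e'G ee' t t' tI t'I).
exists c; split; first by move=> v; apply: cP; left; exists v.
move=> e eG; have [ac ai [u [v [ee a0 a1]]]] := arcP e eG.
exists u, v; split=> //; rewrite -a0 -a1.
exists (fun t => arc e (Num.max 0 (Num.min t 1))); split.
- exact: within_clamp.
- move=> s t; rewrite !in_itv /= => sI tI; rewrite !clamp_id // => /ai.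
  by rewrite !in_itv /=; apply.
- by rewrite clamp_id //; lra.
- by rewrite clamp_id //; lra.
- move=> t tI; rewrite /= clamp_id; last lra.
  apply: cP; right; exists e; split=> //.
  by exists t => //; rewrite in_itv.
Qed.

Lemma coloured_planar G pt c : coloured G pt c -> planar R G.
Proof.
move=> [cpt cG].
have /choice[arc arcP] : forall e, exists g : R -> plane, e \in G ->
    exists a b, e = [set a; b]%SET /\
      [/\ continuous g, {in `[0, 1] &, injective g}, g 0 = pt a, g 1 = pt b &
      forall t, 0 < t < 1 -> c (g t) = Ed e].
  move=> e; have [eG|] := boolP (e \in G); last first.
    by move=> _; exists (fun=> 0).
  by have [a [b [ee [g gP]]]] := cG e eG; exists g => _; exists a, b.
exists pt, arc; split.
- by move=> v v' e; have := cpt v; rewrite e cpt => -[].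
- move=> e /arcP[a [b [ee [gc gi g0 g1 gS]]]]; split=> //.
    exact: continuous_subspaceT.
  by exists a, b.
- move=> e /arcP[a [b [_ [_ _ _ _ gS]]]] t; rewrite in_itv /= => tI v E.
  by have := gS t tI; rewrite E cpt.
- move=> e e' /arcP[a [b [_ [_ _ _ _ gS]]]] /arcP[a' [b' [_ [_ _ _ _ gS']]]].
  move=> ee' t t'; rewrite !in_itv /= => tI t'I E.
  have := gS t tI; rewrite E gS' // => -[E'].
  by rewrite E' eqxx in ee'.
Qed.

End Colouring.

(** * Inversion of the outside of a disc to a half plane *)

Section HalfPlane.
Variable R : realType.
Local Notation plane := (R * R)%type.
Implicit Types p q z A B : plane.

(** Of three distinct points of the circle one avoids both [A] and [B]; it serves as the centre of
    an inversion. *)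
Lemma circle_third_point p A B (r : R) : 0 < r ->
  exists q, [/\ dsq q p = r, q <> A & q <> B].
Proof.
move=> r0; have s0 : 0 < Num.sqrt r by rewrite sqrtr_gt0.
have sE : Num.sqrt r ^+ 2 = r by rewrite sqr_sqrtr // ltW.
set s := Num.sqrt r in s0 sE.
pose q1 : plane := (p.1 + s, p.2).
pose q2 : plane := (p.1 - s, p.2).
pose q3 : plane := (p.1, p.2 + s).
have d1 : dsq q1 p = r by rewrite /dsq /=; nra.
have d2 : dsq q2 p = r by rewrite /dsq /=; nra.
have d3 : dsq q3 p = r by rewrite /dsq /=; nra.
have n12 : q1 <> q2 by move=> [] ?; lra.
have n13 : q1 <> q3 by move=> [] ? ?; lra.
have n23 : q2 <> q3 by move=> [] ? ?; lra.
have [e1|] := pselect (q1 = A \/ q1 = B); last first.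
  by move=> n; exists q1; split=> // e; apply: n; [left|right].
have [e2|] := pselect (q2 = A \/ q2 = B); last first.
  by move=> n; exists q2; split=> // e; apply: n; [left|right].
exists q3; split=> //.
  by case: e1 => e1; case: e2 => e2; congruence.
by case: e1 => e1; case: e2 => e2; congruence.
Qed.

(* The inversion centred at a third point of the circle opens the outside of
   the disc up into a half plane; an affine map then normalises the images of
   [A] and [B]. *)
Lemma half_plane_map p A B (r : R) :
  0 < r -> dsq A p = r -> dsq B p = r -> A <> B ->
  exists F K : plane -> plane,
  [/\ forall z, r < dsq z p \/ z = A \/ z = B ->
        K (F z) = z /\ {for z, continuous F},
      forall z, r < dsq z p -> 0 < (F z).2,
      F A = (0, 0) & F B = (1, 0)].
Proof.
move=> r0 dA dB AB; have [q [dq qA qB]] := circle_third_point p A B r0.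
pose m1 := p.1 - q.1; pose m2 := p.2 - q.2.
have mr : m1 ^+ 2 + m2 ^+ 2 = r by rewrite -dq /dsq /m1 /m2; ring.
pose n z := dsq z q.
have n0 z : z <> q -> n z != 0 by move=> zq; apply/eqP => /dsq_eq0.
(* Up to scaling, [X] and [Y] are the coordinates, across and along the vector from [q] to [p], of
   the inverse of z about [q]; [W] undoes this. *)
pose X z := ((z.1 - q.1) * - m2 + (z.2 - q.2) * m1) / n z.
pose Y z := ((z.1 - q.1) * m1 + (z.2 - q.2) * m2) / n z.
pose W (a b : R) : plane :=
  let w1 := (b * m1 - a * m2) / r in let w2 := (b * m2 + a * m1) / r in
  (q.1 + w1 / (w1 ^+ 2 + w2 ^+ 2), q.2 + w2 / (w1 ^+ 2 + w2 ^+ 2)).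
have WK z : z <> q -> W (X z) (Y z) = z.
  move=> zq; have nz := n0 z zq.
  rewrite /W.
  have -> : (Y z * m1 - X z * m2) / r = (z.1 - q.1) / n z.
    rewrite /X /Y -mr; field; rewrite nz /= mr gt_eqF //.
  have -> : (Y z * m2 + X z * m1) / r = (z.2 - q.2) / n z.
    rewrite /X /Y -mr; field; rewrite nz /= mr gt_eqF //.
  have -> : ((z.1 - q.1) / n z) ^+ 2 + ((z.2 - q.2) / n z) ^+ 2 = (n z)^-1.
    rewrite !expr_div_n -mulrDl -/(dsq z q) -/(n z); field; exact: nz.
  by rewrite !invrK !mulfVK // !subrKC -surjective_pairing.
have dE z : dsq z p = n z - 2 * ((z.1 - q.1) * m1 + (z.2 - q.2) * m2) + r.
  by rewrite -mr /n /dsq /m1 /m2; ring.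
have npos z : z <> q -> 0 < n z.
  by move=> zq; rewrite lt_neqAle eq_sym n0 //= dsq_ge0.
(* The circle passes through the centre of the inversion, so it goes to the line Y = 1/2, and its
   outside to the side Y < 1/2. *)
have YA z : z <> q -> dsq z p = r -> Y z = 1 / 2.
  move=> zq dz; have nz := n0 z zq.
  rewrite /Y.
  have -> : (z.1 - q.1) * m1 + (z.2 - q.2) * m2 = n z / 2.
    by have := dE z; lra.
  by field.
have Ylt z : r < dsq z p -> Y z < 1 / 2.
  move=> dz; have zq : z <> q by move=> e; move: dz; rewrite e dq ltxx.
  rewrite /Y ltr_pdivrMr ?npos //.
  by have := dE z; lra.
have XAB : X B - X A != 0.
  rewrite subr_eq0; apply/eqP => e; apply: AB.
  have Aq : A <> q by apply/nesym.
  have Bq : B <> q by apply/nesym.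
  by rewrite -(WK A Aq) -[RHS](WK B Bq) (YA A Aq dA) (YA B Bq dB) e.
exists (fun z => ((X z - X A) / (X B - X A), 1 - 2 * Y z)).
exists (fun Z => W ((X B - X A) * Z.1 + X A) ((1 - Z.2) / 2)).
split.
- move=> z zP; have zq : z <> q.
    move=> e; case: zP => [|[]]; rewrite e ?dq ?ltxx // => /qA //.
  split.
    rewrite /= mulrCA mulfV // mulr1 subrK.
    have -> : (1 - (1 - 2 * Y z)) / 2 = Y z by field.
    exact: WK.
  have c1 : (fun z : plane => z.1 - q.1) @ z --> z.1 - q.1.
    by apply: cvgB; [exact: cvg_fst|exact: cvg_cst].
  have c2 : (fun z : plane => z.2 - q.2) @ z --> z.2 - q.2.
    by apply: cvgB; [exact: cvg_snd|exact: cvg_cst].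
  have cn : (fun z => (n z)^-1) @ z --> (n z)^-1.
    by apply: cvgV; [exact: n0|exact: continuous_dsq].
  have cX : X @ z --> X z.
    apply: cvgM => //; apply: cvgD; apply: cvgM => //; exact: cvg_cst.
  have cY : Y @ z --> Y z.
    apply: cvgM => //; apply: cvgD; apply: cvgM => //; exact: cvg_cst.
  apply: (@continuous_pair_for R _ (fun z => (X z - X A) / (X B - X A))
    (fun z => 1 - 2 * Y z)).
    apply: cvgM; last exact: cvg_cst.
    by apply: cvgB => //; exact: cvg_cst.
  apply: cvgB; first exact: cvg_cst.
  by apply: cvgM => //; exact: cvg_cst.
- by move=> z /Ylt /=; lra.
- rewrite subrr mul0r YA //; last exact/nesym.
  by congr pair; lra.
- rewrite divff // YA //; last exact/nesym.
  by congr pair; lra.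
Qed.

End HalfPlane.

Lemma set2_eqE (V : finType) (a b u w : V) :
  ([set a; b]%SET == [set u; w]%SET) =
  ((a == u) && (b == w)) || ((a == w) && (b == u)).
Proof.
apply/eqP/orP => [e|[]/andP[/eqP-> /eqP->]] //; last exact: finset.setUC.
have : a \in [set u; w]%SET by rewrite -e !inE eqxx.
have : b \in [set u; w]%SET by rewrite -e !inE eqxx orbT.
have : u \in [set a; b]%SET by rewrite e !inE eqxx.
have : w \in [set a; b]%SET by rewrite e !inE eqxx orbT.
rewrite !inE => /orP[]/eqP h1 /orP[]/eqP h2 /orP[]/eqP h3 /orP[]/eqP h4;
  subst; rewrite ?eqxx; auto.
Qed.

(** * Opening a drawing at an edge and gluing two drawings *)

Section Surgery.
Variables (R : realType) (V : finType).
Local Notation plane := (R * R)%type.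
Local Notation colour := (colour V).
Implicit Types (G : {set {set V}}) (pt : V -> plane) (c : plane -> colour).

Lemma set2_eqP (a b u w : V) : ([set u; w] = [set a; b])%SET ->
  (u = a /\ w = b) \/ (u = b /\ w = a).
Proof.
by move/eqP; rewrite set2_eqE => /orP[]/andP[/eqP-> /eqP->]; [left|right].
Qed.

Lemma coloured_edge G pt c u w : coloured G pt c -> [set u; w]%SET \in G ->
  jarc (pt u) (pt w) [set z | c z = Ed [set u; w]%SET].
Proof.
move=> [_ cG] /cG[a [b [/[dup] e /set2_eqP[[-> ->]|[-> ->]]]]] //.
exact: jarc_sym.
Qed.

(** The disc is centred at the point of parameter 1/2 of the edge and misses all vertices and all
    other edges. [A] and [B] are where the edge meets the boundary circle first and last; whatever
    it does in between is discarded, and the two outer pieces become the halves. *)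
Lemma arc_gap G pt c u w : coloured G pt c -> [set u; w]%SET \in G ->
  exists p r A B (c1 : plane -> colour),
  [/\ [/\ 0 < r, A <> B, dsq A p = r & dsq B p = r],
      forall v, r < dsq (pt v) p /\ c1 (pt v) = Vx v,
      forall e, e \in G -> e <> [set u; w]%SET -> exists a b,
        e = [set a; b]%SET /\
        jarc (pt a) (pt b) [set z | r < dsq z p /\ c1 z = Ed e],
      jarc (pt u) A [set z | r < dsq z p /\ c1 z = Wh V false] &
      jarc (pt w) B [set z | r < dsq z p /\ c1 z = Wh V true]].
Proof.
move=> Gc uwG; have [cpt cG] := Gc.
have [g [gc gi g0 g1 gS]] := coloured_edge Gc uwG.
set e0 := [set u; w]%SET in uwG gS *.
pose p := g (1 / 2).
have cp : c p = Ed e0 by apply: gS; lra.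
have [d1 d10 d1P] : exists2 d, 0 < d & forall v, d <= dsq (pt v) p.
  apply: (@finite_pos_bound R V (fun v d => d <= dsq (pt v) p)).
    move=> v; exists (dsq (pt v) p) => //.
    rewrite lt_neqAle dsq_ge0 andbT eq_sym; apply/eqP => /dsq_eq0 e.
    by have := cpt v; rewrite e cp.
  by move=> v d d' d'd; apply: le_trans; lra.
have [d2 d20 d2P] : exists2 d, 0 < d & forall e, e \in G -> e <> e0 ->
    exists a b, e = [set a; b]%SET /\
      jarc (pt a) (pt b) ([set z | c z = Ed e] `&` [set z | d <= dsq z p]).
  apply: (@finite_pos_bound R _ (fun e d => e \in G -> e <> e0 ->
    exists a b, e = [set a; b]%SET /\
      jarc (pt a) (pt b) ([set z | c z = Ed e] `&` [set z | d <= dsq z p]))).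
    move=> e; have [[eG ee0]|H] := pselect (e \in G /\ e <> e0); last first.
      by exists 1 => // eG ee0; case: H.
    have [a [b [eab ab]]] := cG e eG.
    have [|||d d0 [ab' _ _]] := jarc_avoid (p := p) ab.
    - by rewrite /= cp => -[] /esym.
    - by move=> pa; have := cpt a; rewrite -pa cp.
    - by move=> pb; have := cpt b; rewrite -pb cp.
    by exists d => // _ _; exists a, b.
  move=> e d d' d'd H eG ee0; have [a [b [eab ab]]] := H eG ee0.
  exists a, b; split=> //; apply: jarc_sub ab => z [cz dz]; split=> //=.
  by apply: le_trans dz; lra.
(* Halving makes [r], a squared radius, strictly smaller than both clearances. *)
pose r := Num.min d1 d2 / 2.
have m0 : 0 < Num.min d1 d2 by rewrite lt_min d10.
have m1 : Num.min d1 d2 <= d1 by rewrite ge_min lexx.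
have m2 : Num.min d1 d2 <= d2 by rewrite ge_min lexx orbT.
have [r0 rd1 rd2] : [/\ 0 < r, r < d1 & r < d2] by rewrite /r; split; lra.
have hc : continuous (fun t => dsq (g t) p).
  move=> t; apply: (@continuous_comp _ _ _ g (fun z => dsq z p)).
    exact: gc.
  exact: continuous_dsq.
have hmid : dsq (g (1 / 2)) p < r by rewrite dsqxx.
have [||t0 [t0I ht0 t0P]] := first_hit hc _ _ hmid; first by lra.
  by rewrite g0; apply: lt_le_trans (d1P u).
have [||t1 [t1I ht1 t1P]] := last_hit hc _ _ hmid; first by lra.
  by rewrite g1; apply: lt_le_trans (d1P w).
have gP s t : 0 <= s <= 1 -> 0 <= t <= 1 -> g s = g t -> s = t.
  by move=> sI tI; apply: gi; rewrite in_itv.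
(* Points off the edge keep their colour, the pieces before [t0] and after [t1] become the two
   halves, and the stretch between them gets no label. *)
pose P z l := [\/ l = c z /\ c z <> Ed e0,
  l = Wh V false /\ exists2 t, 0 < t < t0 & z = g t |
  l = Wh V true /\ exists2 t, t1 < t < 1 & z = g t].
have cg t : 0 < t < 1 -> c (g t) = Ed e0 by exact: gS.
have [|c1 c1P] := @colour_of_rel R V P.
  move=> z l l' [[-> cz]|[-> [t tI zt]]|[-> [t tI zt]]];
    move=> [[-> cz']|[-> [t' tI' zt']]|[-> [t' tI' zt']]] //.
  - by case: cz; rewrite zt'; apply: cg; lra.
  - by case: cz; rewrite zt'; apply: cg; lra.
  - by case: cz'; rewrite zt; apply: cg; lra.
  - suff : t < t by rewrite ltxx.
    have tt : t = t' by apply: gP; rewrite -?zt //; lra.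
    by lra.
  - by case: cz'; rewrite zt; apply: cg; lra.
  - suff : t < t by rewrite ltxx.
    have tt : t = t' by apply: gP; rewrite -?zt //; lra.
    by lra.
exists p, r, (g t0), (g t1), c1; split.
- split=> // e; suff : t0 = t1 by lra.
  by apply: gP e; lra.
- move=> v; split; first exact: lt_le_trans (d1P v).
  by apply: c1P; apply: Or31; rewrite cpt.
- move=> e eG ee0; have [a [b [eab ab]]] := d2P e eG ee0.
  exists a, b; split=> //; apply: jarc_sub ab => z [/= cz dz]; split.
    exact: lt_le_trans dz.
  by apply: c1P; apply: Or31; rewrite cz; split=> // -[].
- rewrite -g0; apply: jarc_sub_arc => //; last 2 first.
  + by lra.
  + move=> t tI; split; first by apply: t0P; lra.
    by apply: c1P; apply: Or32; split=> //; exists t.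
  by move=> s t; rewrite !in_itv /= => sI tI; apply: gP; lra.
- apply: jarc_sym; rewrite -g1; apply: jarc_sub_arc => //; last 2 first.
  + by lra.
  + move=> t tI; split; first by apply: t1P; lra.
    by apply: c1P; apply: Or33; split=> //; exists t.
  by move=> s t; rewrite !in_itv /= => sI tI; apply: gP; lra.
Qed.

(** The drawing opened up at the edge uw: its halves end at two ports on the boundary line, and all
    the rest lies strictly above that line. *)
Definition half_plane_drawing G (u w : V) pt c : Prop :=
  [/\ forall v, 0 < (pt v).2 /\ c (pt v) = Vx v,
      forall e, e \in G -> e <> [set u; w]%SET -> exists a b,
        e = [set a; b]%SET /\
        jarc (pt a) (pt b) [set z | 0 < z.2 /\ c z = Ed e],
      jarc (pt u) (0, 0) [set z | 0 < z.2 /\ c z = Wh V false] &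
      jarc (pt w) (1, 0) [set z | 0 < z.2 /\ c z = Wh V true]].

Lemma half_plane_drawing_exists G u w : planar R G -> [set u; w]%SET \in G ->
  exists pt c, half_plane_drawing G u w pt c.
Proof.
move=> /planar_coloured[pt [c Gc]] uwG.
have [p [r [A [B [c1 [[r0 AB dA dB] c1pt c1G c1u c1w]]]]]] := arc_gap Gc uwG.
have [F [K [FK Fpos FA FB]]] := half_plane_map r0 dA dB AB.
exists (fun v => F (pt v)), (fun z => c1 (K z)).
have FKs z : r < dsq z p -> K (F z) = z by move=> zp; apply: (FK z _).1; left.
have mapP a b (l : colour) :
    (r < dsq a p \/ a = A \/ a = B) -> (r < dsq b p \/ b = A \/ b = B) ->
    jarc a b [set z | r < dsq z p /\ c1 z = l] ->
    jarc (F a) (F b) [set z | 0 < z.2 /\ c1 (K z) = l].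
  move=> aP bP ab.
  have zP z : [set z | r < dsq z p /\ c1 z = l] z \/ z = a \/ z = b ->
      r < dsq z p \/ z = A \/ z = B.
    by case=> [[]|[->|->]] //; left.
  apply: (@jarc_sub _ _ _ (F @` [set z | r < dsq z p /\ c1 z = l])).
    by move=> _ [z [dz cz] <-]; split; [exact: Fpos|rewrite FKs].
  apply: jarc_map ab.
    by move=> z /zP /FK[].
  move=> z z' /zP /FK[Kz _] /zP /FK[Kz' _] e.
  by rewrite -Kz e.
have ptP v : r < dsq (pt v) p \/ pt v = A \/ pt v = B.
  by left; exact: (c1pt v).1.
split.
- move=> v; have [dv cv] := c1pt v; split; first exact: Fpos.
  by rewrite FKs.
- move=> e eG ee0; have [a [b [eab ab]]] := c1G e eG ee0.
  by exists a, b; split=> //; exact: mapP.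
- by rewrite -FA; apply: mapP => //; right; left.
- by rewrite -FB; apply: mapP => //; right; right.
Qed.

Lemma jarc_shift (A B : plane) (h : R) (S : set plane) : jarc A B S ->
  jarc (A.1, A.2 + h) (B.1, B.2 + h) [set z | S (z.1, z.2 - h)].
Proof.
move=> AB; apply: (@jarc_sub _ _ _ ((fun z : plane => (z.1, z.2 + h)) @` S)).
  by move=> _ [[a b] Sab <-] /=; rewrite addrK.
apply: (@jarc_map _ (fun z : plane => (z.1, z.2 + h))) AB.
  move=> z _; apply: (@continuous_pair_for R _ fst (fun z => z.2 + h)).
    exact: cvg_fst.
  by apply: cvgD; [exact: cvg_snd|exact: cvg_cst].
by move=> [a b] [a' b'] _ _ /= [-> /addIr ->].
Qed.

Lemma jarc_flip (A B : plane) (S : set plane) : jarc A B S ->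
  jarc (A.1, - A.2) (B.1, - B.2) [set z | S (z.1, - z.2)].
Proof.
move=> AB; apply: (@jarc_sub _ _ _ ((fun z : plane => (z.1, - z.2)) @` S)).
  by move=> _ [[a b] Sab <-] /=; rewrite opprK.
apply: (@jarc_map _ (fun z : plane => (z.1, - z.2))) AB.
  move=> z _; apply: (@continuous_pair_for R _ fst (fun z => - z.2)).
    exact: cvg_fst.
  by apply: cvgN; exact: cvg_snd.
by move=> [a b] [a' b'] _ _ /= [-> /oppr_inj ->].
Qed.

(** The drawing of [G], opened at xy and raised by 1, is kept above height 1 without the vertices
    and edges in [C]. A drawing of [C] below height 1, with arcs from [u] and [w] ending at the
    ports (0, 1) and (1, 1), is attached there, and the halves of xy complete the edges ux and
    wy. *)
Lemma glue_planar G G' (C : {set V}) u w x y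
    (ptl : V -> plane) (cl : plane -> colour) :
  planar R G -> [set x; y]%SET \in G -> x \notin C -> y \notin C ->
  u \in C -> w \in C ->
  (forall v, v \in C -> (ptl v).2 < 1 /\ cl (ptl v) = Vx v) ->
  jarc (ptl u) (0, 1) [set z | z.2 < 1 /\ cl z = Ed [set u; x]%SET] ->
  jarc (ptl w) (1, 1) [set z | z.2 < 1 /\ cl z = Ed [set w; y]%SET] ->
  (forall e, e \in G' ->
    [\/ e = [set u; x]%SET, e = [set w; y]%SET,
      [/\ e \in G, e <> [set x; y]%SET & forall v, v \in e -> v \notin C] |
      exists a b, [/\ e = [set a; b]%SET, a \in C, b \in C &
        jarc (ptl a) (ptl b) [set z | z.2 < 1 /\ cl z = Ed e]]]) ->
  planar R G'.
Proof.
move=> Gp xyG xC yC uC wC clpt clu clw G'P.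
have [pt [c [cpt cG cx cy]]] := half_plane_drawing_exists Gp xyG.
pose rel (l : colour) : colour :=
  if l is Some (inr b) then Ed (if b then [set w; y] else [set u; x])%SET else l.
(* On the line of height 1 only the two ports matter; nothing else is drawn there, so the colour of
   its other points is arbitrary. *)
pose c' (z : plane) : colour := if z.2 < 1 then cl z else
  if 1 < z.2 then rel (c (z.1, z.2 - 1)) else
  if z.1 == 0 then Ed [set u; x]%SET else Ed [set w; y]%SET.
pose pt' v : plane := if v \in C then ptl v else ((pt v).1, (pt v).2 + 1).
have low (z : plane) : z.2 < 1 -> c' z = cl z by rewrite /c' => ->.
have high (z : plane) : 1 < z.2 -> c' z = rel (c (z.1, z.2 - 1)).
  by rewrite /c' => z1; rewrite ltNge (ltW z1) z1.
have lowS (A B : plane) (l : colour) :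
    jarc A B [set z | z.2 < 1 /\ cl z = l] ->
    jarc A B [set z | z.2 < 1 /\ c' z = l].
  by apply: jarc_sub => z [z1 cz]; split=> //; rewrite low.
have highS (A B : plane) (l : colour) :
    jarc A B [set z | 0 < z.2 /\ c z = l] ->
    jarc (A.1, A.2 + 1) (B.1, B.2 + 1) [set z | 1 < z.2 /\ c' z = rel l].
  move=> /(@jarc_shift _ _ 1); apply: jarc_sub => z /= [z1 cz].
  by have z2 : 1 < z.2 by [lra]; split=> //; rewrite high // cz.
have cross (a b : V) (h : R) (l k : colour) : a \in C -> b \notin C ->
    jarc (ptl a) (h, 1) [set z | z.2 < 1 /\ cl z = l] ->
    jarc (pt b) (h, 0) [set z | 0 < z.2 /\ c z = k] -> rel k = l ->
    c' (h, 1) = l ->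
    jarc (pt' a) (pt' b) [set z | c' z = l].
  move=> aC bC /lowS al /highS; rewrite /= add0r => bk kl ch.
  rewrite /pt' aC (negbTE bC).
  apply: (jarc_cat al (jarc_sym bk)) => //.
  - have aP := (clpt a aC).1; have bP : 1 < (pt b).2 + 1.
      by have := (cpt b).1; lra.
    move=> z zl zh; have : z.2 < 1 by case: zl => [[]|->].
    have : 1 < z.2 by case: zh => [[]|->].
    by move=> z1 z2; have := lt_trans z1 z2; rewrite ltxx.
  - by move=> z [].
  - by move=> z [_]; rewrite kl.
have c01 : c' (0, 1) = Ed [set u; x]%SET by rewrite /c' /= ltxx eqxx.
have c11 : c' (1, 1) = Ed [set w; y]%SET.
  by rewrite /c' /= ltxx (gt_eqF ltr01).
apply: (@coloured_planar _ _ _ pt' c'); split.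
  move=> v; rewrite /pt'; case: ifP => vC.
    by have [v1 cv] := clpt v vC; rewrite low.
  have [v0 cv] := cpt v; rewrite high /=; last lra.
  by rewrite addrK -surjective_pairing cv.
move=> e /G'P[->|->|[eG exy eC]|[a [b [eab aC bC ab]]]].
- by exists u, x; split=> //; apply: cross cx _ _.
- by exists w, y; split=> //; apply: cross cy _ _.
- have [a [b [eab ab]]] := cG e eG exy; exists a, b; split=> //.
  rewrite /pt' !ifN ?eC ?eab ?inE ?eqxx ?orbT //.
  by have := highS _ _ _ ab; apply: jarc_sub => z /= [_ ->]; rewrite eab.
- exists a, b; split=> //; rewrite /pt' aC bC.
  by have := lowS _ _ _ ab; apply: jarc_sub => z /= [_ ->].
Qed.

End Surgery.

(** * Switches and their planarity *)

Section Switch.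
Variable V : finType.
Implicit Types (G : {set {set V}}) (C : {set V}).

(** The Boolean tells whether uw is deleted along with xy. Taking u = w reroutes xy through u; in a
    simple graph, u = w and x = y merely joins u to x. *)
Definition switch (b : bool) (u w x y : V) G : {set {set V}} :=
  ([set [set u; x]; [set w; y]] :|:
   (G :\: ([set x; y] |: if b then [set [set u; w]] else finset.set0)))%SET.

Lemma in_switch b u w x y G e : (e \in switch b u w x y G) =
  [|| e == [set u; x]%SET, e == [set w; y]%SET |
    [&& e \in G, e != [set x; y]%SET & b ==> (e != [set u; w]%SET)]].
Proof.
rewrite !inE negb_or; case: b => /=; rewrite !inE /=; last first.
  by rewrite andbT [_ && (e \in G)]andbC orbA.
by rewrite andbC orbA.
Qed.

(** Expresses that [C] is a union of vertex sets of components without mentioning connectivity. *)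
Definition closed_set G C := forall a b : V,
  ([set a; b]%SET \in G) -> (a \in C) = (b \in C).
End Switch.

Section PlanarSwitch.
Variables (R : realType) (V : finType).
Local Notation plane := (R * R)%type.
Local Notation colour := (colour V).
Implicit Types (G : {set {set V}}) (C : {set V}).

Lemma edge_dichotomy G C e : planar R G -> closed_set G C -> e \in G ->
  (forall v, v \in e -> v \notin C) \/ (forall v, v \in e -> v \in C).
Proof.
move=> /planar_coloured[pt [c [_ cG]]] GC eG.
have [a [b [eab _]]] := cG e eG.
have := GC a b; rewrite -eab => /(_ eG) ab.
have [aC|aC] := boolP (a \in C); [right|left] => v; rewrite eab !inE;
  by case/orP => /eqP-> //; rewrite -ab.
Qed.

Lemma half_plane_flip G u w (pt : V -> plane) (c : plane -> colour) e :
  half_plane_drawing G u w pt c -> e \in G -> e <> [set u; w]%SET ->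
  exists a b, e = [set a; b]%SET /\
    jarc ((pt a).1, - (pt a).2) ((pt b).1, - (pt b).2)
      [set z | z.2 < 0 /\ c (z.1, - z.2) = Ed e].
Proof.
move=> [_ cG _ _] eG euw; have [a [b [eab ab]]] := cG e eG euw.
exists a, b; split=> //; have := jarc_flip ab; apply: jarc_sub => z /= [? ?].
by split=> //; lra.
Qed.

(* The part of the drawing between a vertex at (1, 0) and the ports of the
   upper half plane. *)
Let fan (lu l0 l1 : colour) (z : plane) : colour :=
  if z.1 == 1 then (if z.2 == 0 then lu else l1) else l0.

Let fan_left lu l0 l1 :
  jarc (1, 0) (0, 1) [set z : plane | (0 <= z.2 < 1) /\ fan lu l0 l1 z = l0].
Proof.
apply: jarc_segment => [[e _]|t tI /=]; first by lra.
split; first by lra.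
by rewrite /fan /= (_ : _ == 1 = false) //; apply/eqP; lra.
Qed.

Let fan_right lu l0 l1 :
  jarc (1, 0) (1, 1) [set z : plane | (0 <= z.2 < 1) /\ fan lu l0 l1 z = l1].
Proof.
apply: jarc_segment => [[/eqP]|t tI /=]; first by rewrite eq_sym oner_eq0.
split; first by lra.
rewrite /fan /= (_ : _ == 1 = true); last by apply/eqP; lra.
by rewrite (_ : _ == 0 = false) //; apply/eqP; lra.
Qed.

(** The lower part of the glued drawing is just [u] at (1, 0) with segments to both ports. *)
Lemma planar_switch_isolated G u x y : planar R G -> [set x; y]%SET \in G ->
  (forall b, [set u; b]%SET \notin G) -> planar R (switch false u u x y G).
Proof.
move=> Gp xyG uG.
have ux : u != x by apply/eqP => e; have := uG y; rewrite e xyG.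
have uy : u != y by apply/eqP => e; have := uG x; rewrite e finset.setUC xyG.
have GC : closed_set G [set u]%SET.
  move=> a b abG; rewrite !inE; apply/eqP/eqP => e; subst.
    by have := uG b; rewrite abG.
  by have := uG a; rewrite finset.setUC abG.
pose cl := fan (Vx u) (Ed [set u; x]%SET) (Ed [set u; y]%SET).
apply: (@glue_planar R V G _ [set u]%SET u u x y (fun=> (1, 0)) cl) => //;
  rewrite ?inE ?eqxx 1?eq_sym //.
- by move=> v; rewrite inE => /eqP->; rewrite /cl /fan /= !eqxx; split=> //; lra.
- apply: jarc_sub (fan_left (Vx u) (Ed [set u; x]%SET) (Ed [set u; y]%SET)).
  by move=> z [/andP[_ z1] cz].
- apply: jarc_sub (fan_right (Vx u) (Ed [set u; x]%SET) (Ed [set u; y]%SET)).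
  by move=> z [/andP[_ z1] cz].
move=> e; rewrite in_switch => /or3P[/eqP->|/eqP->|/and3P[eG /eqP exy _]].
- exact: Or41.
- exact: Or42.
apply: Or43; split=> // v ve; rewrite inE; apply/eqP => vu; subst v.
have [pt [c [_ cG]]] := planar_coloured Gp.
have [a [b [eab _]]] := cG e eG; move: ve eG; rewrite eab !inE.
by case/orP => /eqP <-; rewrite ?(negbTE (uG _)) // finset.setUC (negbTE (uG _)).
Qed.


Let flip (z : plane) : plane := (z.1, - z.2).

(** The drawing is opened at uw and flipped below the axis. Moving [u] to the port where the half
    coming from [w] ends turns that half into the edge uw, and the fan above joins [u] to both upper
    ports. *)
Lemma planar_switch_leaf G C u w x y : planar R G -> closed_set G C ->
  u \in C -> x \notin C -> y \notin C -> [set x; y]%SET \in G -> w != u ->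
  [set u; w]%SET \in G -> (forall b, [set u; b]%SET \in G -> b = w) ->
  planar R (switch false u u x y G).
Proof.
move=> Gp GC uC xC yC xyG wu uwG uleaf.
have wC : w \in C by rewrite -(GC u w uwG).
have [pt [c hp]] := half_plane_drawing_exists Gp uwG.
have [cpt cG cu cw] := hp.
pose rel (l : colour) : colour :=
  if l is Some (inr _) then Ed [set u; w]%SET else l.
pose cl (z : plane) : colour := if z.2 < 0 then rel (c (flip z))
  else fan (Vx u) (Ed [set u; x]%SET) (Ed [set u; y]%SET) z.
pose ptl v := if v == u then (1, 0) else flip (pt v).
have cl0 (z : plane) : 0 <= z.2 ->
    cl z = fan (Vx u) (Ed [set u; x]%SET) (Ed [set u; y]%SET) z.
  by rewrite /cl ltNge => ->.
apply: (@glue_planar R V G _ C u u x y ptl cl) => //.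
- move=> v vC; rewrite /ptl; case: eqP => [->|_].
    by rewrite cl0 //= /fan /= !eqxx; split=> //; lra.
  have [v0 cv] := cpt v; rewrite /cl /=.
  have -> : - (pt v).2 < 0 by lra.
  rewrite /flip /= opprK -surjective_pairing cv; split=> //; lra.
- rewrite /ptl eqxx.
  apply: jarc_sub (fan_left (Vx u) (Ed [set u; x]%SET) (Ed [set u; y]%SET)).
  by move=> z [/andP[z0 z1] cz]; split=> //; rewrite cl0.
- rewrite /ptl eqxx.
  apply: jarc_sub (fan_right (Vx u) (Ed [set u; x]%SET) (Ed [set u; y]%SET)).
  by move=> z [/andP[z0 z1] cz]; split=> //; rewrite cl0.
move=> e; rewrite in_switch => /or3P[/eqP->|/eqP->|/and3P[eG /eqP exy _]].
- exact: Or41.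
- exact: Or42.
have [eC|eC] := edge_dichotomy Gp GC eG; first exact: Or43.
apply: Or44; have [e1|/eqP e1] := eqVneq e [set u; w]%SET.
  exists u, w; split=> //; apply: jarc_sym; rewrite /ptl eqxx (negbTE wu).
  have := jarc_flip cw; rewrite /= oppr0; apply: jarc_sub => z /= [z0 cz].
  have z0' : z.2 < 0 by lra.
  by split; [lra|rewrite /cl z0' /flip cz e1].
have [a [b [eab ab]]] := half_plane_flip hp eG e1.
have aC : a \in C by apply: eC; rewrite eab !inE eqxx.
have bC : b \in C by apply: eC; rewrite eab !inE eqxx orbT.
have au : a != u.
  by apply/eqP => au; apply: e1; subst a; rewrite eab (uleaf b) // -eab.
have bu : b != u.
  apply/eqP => bu; apply: e1; subst b.
  by rewrite eab finset.setUC (uleaf a) // finset.setUC -eab.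
exists a, b; split=> //; rewrite /ptl (negbTE au) (negbTE bu).
apply: jarc_sub ab => z /= [z0 cz]; split; first lra.
by rewrite /cl z0 /flip cz.
Qed.

(** The flipped drawing leaves the halves of uw at (0, 0) and (1, 0); vertical segments carry them
    up to the upper ports, where they continue as the halves of xy. *)
Lemma planar_switch_cut G C u w x y : planar R G -> closed_set G C ->
  u \in C -> x \notin C -> y \notin C -> [set x; y]%SET \in G ->
  [set u; w]%SET \in G -> planar R (switch true u w x y G).
Proof.
move=> Gp GC uC xC yC xyG uwG.
have wC : w \in C by rewrite -(GC u w uwG).
have [pt [c hp]] := half_plane_drawing_exists Gp uwG.
have [cpt cG cu cw] := hp.
pose rel (l : colour) : colour :=
  if l is Some (inr b) then Ed (if b then [set w; y] else [set u; x])%SET else l.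
pose cl (z : plane) : colour := if z.2 < 0 then rel (c (flip z))
  else if z.1 == 0 then Ed [set u; x]%SET else Ed [set w; y]%SET.
pose ptl v := flip (pt v).
have port a (h : R) b l : cl (h, 0) = l -> rel (Wh V b) = l ->
    (forall t : R, 0 <= t < 1 -> cl (h, t) = l) ->
    jarc (pt a) (h, 0) [set z | 0 < z.2 /\ c z = Wh V b] ->
    jarc (ptl a) (h, 1) [set z | z.2 < 1 /\ cl z = l].
  move=> ch rb clt /jarc_flip; rewrite /= oppr0 => ah.
  have h1 : jarc (h, 0) (h, 1) [set z : plane | 0 < z.2 < 1 /\ cl z = l].
    apply: jarc_segment => [[/eqP]|t tI /=]; first by rewrite eq_sym oner_eq0.
    split; first by lra.
    have -> : (h - h) * t + h = h by ring.
    by apply: clt; lra.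
  apply: (jarc_cat ah h1).
  - have a0 := (cpt a).1.
    move=> z zl zh; have z0 : z.2 < 0 by case: zl => [[]|->] /=; lra.
    have z1 : 0 < z.2 by case: zh => [[/andP[]]|->].
    by have := lt_trans z0 z1; rewrite ltxx.
  - move=> z /= [z0 cz]; have z0' : z.2 < 0 by lra.
    by split; [lra|rewrite /cl z0' /flip cz].
  - by move=> z [/andP[_ z1] cz].
  - by split.
apply: (@glue_planar R V G _ C u w x y ptl cl) => //.
- move=> v vC; rewrite /ptl; have [v0 cv] := cpt v; rewrite /cl /=.
  have -> : - (pt v).2 < 0 by lra.
  rewrite /flip /= opprK -surjective_pairing cv; split=> //; lra.
- apply: port cu => //; first by rewrite /cl /= ltxx eqxx.
  by move=> t /andP[t0 _]; rewrite /cl /= ltNge t0 eqxx.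
- apply: port cw => //; first by rewrite /cl /= ltxx (gt_eqF ltr01).
  by move=> t /andP[t0 _]; rewrite /cl /= ltNge t0 (gt_eqF ltr01).
move=> e; rewrite in_switch => /or3P[/eqP->|/eqP->|/and3P[eG /eqP exy /eqP euw]].
- exact: Or41.
- exact: Or42.
have [eC|eC] := edge_dichotomy Gp GC eG; first exact: Or43.
apply: Or44.
have [a [b [eab ab]]] := half_plane_flip hp eG euw.
have aC : a \in C by apply: eC; rewrite eab !inE eqxx.
have bC : b \in C by apply: eC; rewrite eab !inE eqxx orbT.
exists a, b; split=> //.
apply: jarc_sub ab => z /= [z0 cz]; split; first lra.
by rewrite /cl z0 /flip cz.
Qed.

(** As [u] and [w] have no neighbours but each other, [v] and [v'], they can be moved to the ports
    (0, 0) and (1, 0). The edge uw becomes the segment between them, and the edge uv follows the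
    half of uw from the port back through the old place of [u]; likewise at [w]. *)
Lemma planar_switch_pair G C u w v v' x y : planar R G -> closed_set G C ->
  u \in C -> x \notin C -> y \notin C -> [set x; y]%SET \in G -> u != w ->
  [set u; w]%SET \in G -> [set u; v]%SET \in G -> [set w; v']%SET \in G ->
  v != u -> v != w -> v' != u -> v' != w ->
  (forall b, [set u; b]%SET \in G -> b = w \/ b = v) ->
  (forall b, [set w; b]%SET \in G -> b = u \/ b = v') ->
  planar R (switch false u w x y G).
Proof.
move=> Gp GC uC xC yC xyG uw uwG uvG wvG vu vw v'u v'w uN wN.
have wC : w \in C by rewrite -(GC u w uwG).
have vC : v \in C by rewrite -(GC u v uvG).
have v'C : v' \in C by rewrite -(GC w v' wvG).
have [pt [c hp]] := half_plane_drawing_exists Gp uwG.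
have [cpt cG cu cw] := hp.
(* The old places of [u] and [w] turn into interior points of the redrawn edges. *)
pose rel (l : colour) : colour := match l with
  | Some (inl (inl a)) =>
      if a == u then Ed [set u; v]%SET else
      if a == w then Ed [set w; v']%SET else l
  | Some (inr b) => Ed (if b then [set w; v'] else [set u; v])%SET
  | _ => l end.
pose cl (z : plane) : colour := if z.2 < 0 then rel (c (flip z)) else
  if z.2 == 0 then
    if z.1 == 0 then Vx u else if z.1 == 1 then Vx w else Ed [set u; w]%SET
  else if z.1 == 0 then Ed [set u; x]%SET else Ed [set w; y]%SET.
pose ptl a : plane :=
  if a == u then (0, 0) else if a == w then (1, 0) else flip (pt a).
have port (h : R) l : (forall t : R, 0 < t < 1 -> cl (h, t) = l) ->
    jarc (h, 0) (h, 1) [set z : plane | z.2 < 1 /\ cl z = l].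
  move=> clt; apply: jarc_segment => [[/eqP]|t tI /=]; first by rewrite eq_sym oner_eq0.
  split; first by lra.
  have -> : (h - h) * t + h = h by ring.
  by apply: clt; lra.
have clneg (z : plane) : z.2 < 0 -> cl z = rel (c (flip z)).
  by rewrite /cl => ->.
have redraw a s (h : R) b : a != s -> [set s; a]%SET \in G ->
    [set s; a]%SET <> [set u; w]%SET ->
    rel (Vx s) = Ed [set s; a]%SET -> rel (Wh V b) = Ed [set s; a]%SET ->
    jarc (pt s) (h, 0) [set z | 0 < z.2 /\ c z = Wh V b] ->
    jarc (h, 0) (flip (pt a)) [set z | z.2 < 1 /\ cl z = Ed [set s; a]%SET].
  move=> as_ saG sa relV relW /jarc_flip; rewrite /= oppr0 => sh.
  have [a' [b' [eab ab]]] := half_plane_flip hp saG sa.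
  have {a' b' eab ab} sa' : jarc (flip (pt s)) (flip (pt a))
      [set z | z.2 < 0 /\ c (z.1, - z.2) = Ed [set s; a]%SET].
    by case: (set2_eqP eab) => -[? ?]; subst a' b' => //; exact: jarc_sym.
  have [s0 cs] := cpt s; have [a0 ca] := cpt a.
  apply: (jarc_cat (jarc_sym sh) sa').
  - move=> z [[/= z0 cz]|->] [[/= z0' cz']|ez] //.
    + by move: cz; rewrite cz'.
    + by move: cz; rewrite ez /flip /= opprK -surjective_pairing ca.
    + by move: z0'; rewrite ltxx.
    + have : - (pt a).2 < 0 by lra.
      by case: ez => _ <-; rewrite ltxx.
  - move=> z /= [z0 cz]; have z0' : z.2 < 0 by lra.
    by split; [lra|rewrite clneg // /flip cz].
  - move=> z /= [z0 cz]; split; first lra.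
    by rewrite clneg // /flip cz.
  - have n0 : - (pt s).2 < 0 by lra.
    by split=> /=; [lra|rewrite clneg // /flip /= opprK -surjective_pairing cs].
apply: (@glue_planar R V G _ C u w x y ptl cl) => //.
- move=> a aC; rewrite /ptl; case: eqP => [->|/eqP au].
    by rewrite /cl /= ltxx !eqxx; split=> //; lra.
  case: eqP => [->|/eqP aw].
    by rewrite /cl /= ltxx !eqxx (gt_eqF ltr01); split=> //; lra.
  have [a0 ca] := cpt a; have n0 : - (pt a).2 < 0 by lra.
  rewrite clneg // /flip /= opprK -surjective_pairing ca /=.
  by rewrite (negbTE au) (negbTE aw); split=> //; lra.
- rewrite /ptl eqxx; apply: port => t /andP[t0 _].
  by rewrite /cl /= ltNge (ltW t0) (gt_eqF t0) eqxx.
- rewrite /ptl eqxx eq_sym (negbTE uw); apply: port => t /andP[t0 _].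
  by rewrite /cl /= ltNge (ltW t0) (gt_eqF t0) (gt_eqF ltr01).
move=> e; rewrite in_switch => /or3P[/eqP->|/eqP->|/and3P[eG /eqP exy _]].
- exact: Or41.
- exact: Or42.
have [eC|eC] := edge_dichotomy Gp GC eG; first exact: Or43.
apply: Or44; have [->|/eqP e1] := eqVneq e [set u; w]%SET.
  exists u, w; split=> //; rewrite /ptl !eqxx eq_sym (negbTE uw).
  apply: jarc_segment => [[/eqP]|t tI /=]; first by rewrite eq_sym oner_eq0.
  split; first by lra.
  have -> : (0 - 0) * t + 0 = 0 :> R by ring.
  rewrite /cl /= ltxx eqxx !ifN //; apply/eqP; lra.
have wu : w != u by rewrite eq_sym.
have [->|/eqP e2] := eqVneq e [set u; v]%SET.
  exists u, v; split=> //; rewrite /ptl eqxx (negbTE vu) (negbTE vw).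
  apply: redraw cu => //; last by rewrite /rel /Vx eqxx.
  by move=> /set2_eqP[[_ E]|[E _]]; [move/eqP: vw|move/eqP: uw].
have [->|/eqP e3] := eqVneq e [set w; v']%SET.
  exists w, v'; split=> //; rewrite /ptl (negbTE wu) eqxx (negbTE v'u) (negbTE v'w).
  apply: redraw cw => //; last by rewrite /rel /Vx (negbTE wu) eqxx.
  by move=> /set2_eqP[[E _]|[_ E]]; [move/eqP: wu|move/eqP: v'u].
have [a [b [eab ab]]] := half_plane_flip hp eG e1.
have aC : a \in C by apply: eC; rewrite eab !inE eqxx.
have bC : b \in C by apply: eC; rewrite eab !inE eqxx orbT.
have nend s s' : [set s; s']%SET = e -> s != u /\ s != w.
  move=> ss; split; apply/eqP => E; subst s.
    by case: (uN s') => [|E|E]; [rewrite ss|apply: e1; rewrite -ss E|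
      apply: e2; rewrite -ss E].
  by case: (wN s') => [|E|E]; [rewrite ss|
    apply: e1; rewrite -ss E finset.setUC|apply: e3; rewrite -ss E].
have [au aw] := nend a b (esym eab).
have [bu bw] : b != u /\ b != w by apply: (nend b a); rewrite finset.setUC.
exists a, b; split=> //.
rewrite /ptl (negbTE au) (negbTE bu) (negbTE aw) (negbTE bw).
apply: jarc_sub ab => z /= [z0 cz]; split; first lra.
by rewrite clneg // /flip cz.
Qed.

(** A small disc around [u] is free of all edges and other vertices; the isolated vertex [x] is
    redrawn inside it. *)
Lemma planar_join_isolated G u x : planar R G -> u != x ->
  (forall b, [set u; b]%SET \notin G) -> (forall b, [set x; b]%SET \notin G) ->
  planar R (switch false u u x x G).
Proof.
move=> /planar_coloured[pt [c [cpt cG]]] ux uG xG.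
pose p := pt u.
have [d1 d10 d1P] : exists2 d, 0 < d & forall v, v != u -> d <= dsq (pt v) p.
  apply: (@finite_pos_bound R V (fun v d => v != u -> d <= dsq (pt v) p)).
    move=> v; have [->|vu] := eqVneq v u; first by exists 1.
    exists (dsq (pt v) p) => //.
    rewrite lt_neqAle dsq_ge0 andbT eq_sym; apply/eqP => /dsq_eq0 e.
    have := cpt v; rewrite e cpt => -[] E.
    by rewrite E eqxx in vu.
  by move=> v d d' /andP[_ d'd] H vu; apply: le_trans d'd (H vu).
have ends e a b : e \in G -> e = [set a; b]%SET ->
    [/\ a != u, b != u, a != x & b != x].
  move=> eG eab; split; apply/eqP => E; subst; move: eG; apply/negP => //;
  by rewrite finset.setUC.
have [d2 d20 d2P] : exists2 d, 0 < d & forall e, e \in G ->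
    exists a b, e = [set a; b]%SET /\
      jarc (pt a) (pt b) ([set z | c z = Ed e] `&` [set z | d <= dsq z p]).
  apply: (@finite_pos_bound R _ (fun e d => e \in G ->
    exists a b, e = [set a; b]%SET /\
      jarc (pt a) (pt b) ([set z | c z = Ed e] `&` [set z | d <= dsq z p]))).
    move=> e; have [eG|eG] := boolP (e \in G); last by exists 1.
    have [a [b [eab ab]]] := cG e eG.
    have [au bu _ _] := ends e a b eG eab.
    have [|||d d0 [ab' _ _]] := jarc_avoid (p := p) ab.
    - by rewrite /= /p cpt.
    - move=> pa; have := cpt a; rewrite -pa cpt => -[] E.
      by rewrite E eqxx in au.
    - move=> pb; have := cpt b; rewrite -pb cpt => -[] E.
      by rewrite E eqxx in bu.
    by exists d => // _; exists a, b.
  move=> e d d' /andP[_ d'd] H eG; have [a [b [eab ab]]] := H eG.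
  exists a, b; split=> //; apply: jarc_sub ab => z [cz dz]; split=> //=.
  exact: le_trans dz.
(* [d] bounds squared distances; with [d <= 1] the points at distance at most d/2 from [p] lie
   strictly inside the disc. *)
pose d := Num.min 1 (Num.min d1 d2).
have [d0 dd1 dd2 d_1] : [/\ 0 < d, d <= d1, d <= d2 & d <= 1].
  by rewrite /d !lt_min d10 d20 ltr01 !ge_min !lexx !orbT.
pose q : plane := (p.1 + d / 2, p.2).
pose pt' v := if v == x then q else pt v.
pose c' (z : plane) : colour := if dsq z p < d then
  (if z == p then Vx u else if z == q then Vx x else Ed [set u; x]%SET) else c z.
have far (z : plane) : d <= dsq z p -> c' z = c z by rewrite /c' ltNge => ->.
have qp : q == p = false.
  apply/negbTE/eqP => /(congr1 fst) /= E; suff : 0 < (0 : R) by rewrite ltxx.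
  by lra.
apply: (@coloured_planar _ _ _ pt' c'); split.
  move=> v; rewrite /pt'; case: eqP => [->|/eqP vx].
    rewrite /c' qp eqxx ifT // /dsq /=; nra.
  have [->|vu] := eqVneq v u; first by rewrite /c' dsqxx d0 eqxx.
  by rewrite far ?cpt //; apply: le_trans dd1 (d1P v vu).
move=> e; rewrite in_switch orbA orbb => /orP[/eqP->|/and3P[eG _ _]].
  exists u, x; split=> //; rewrite /pt' (negbTE ux) eqxx.
  apply: jarc_segment => [/esym/eqP|t tI]; first by rewrite -/p qp.
  rewrite /= -/p; set z : plane := (_, _).
  have z1 : z.1 = p.1 + d / 2 * t by rewrite /z /=; ring.
  have z2 : z.2 = p.2 by rewrite /z /=; ring.
  have [k0 kd] : 0 < d / 2 * t /\ d / 2 * t < d / 2 by split; nra.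
  move: (d / 2 * t) k0 kd z1 => k k0 kd z1.
  rewrite /c' ifT; last first.
    rewrite /dsq z1 z2 subrr [p.1 + k]addrC addrK; nra.
  rewrite !ifN //; apply/eqP => /(congr1 fst); rewrite z1 /= => E.
    by suff : 0 < (0 : R) by [rewrite ltxx]; lra.
  by suff : 0 < (0 : R) by [rewrite ltxx]; lra.
have [a [b [eab ab]]] := d2P e eG; exists a, b; split=> //.
have [_ _ ax bx] := ends e a b eG eab.
rewrite /pt' (negbTE ax) (negbTE bx); apply: jarc_sub ab => z [/= cz dz].
by rewrite far //; apply: le_trans dd2 dz.
Qed.

End PlanarSwitch.

Local Close Scope classical_set_scope.
(* From here on, names such as set0 and setUC are those of finset again, not
   those of classical_sets. *)
From mathcomp Require Import finset.

(** * Good edges at the end of a longest path *)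

Section Gadget.
Local Open Scope nat_scope.
Local Open Scope set_scope.
Variable V : finType.
Implicit Types (G : {set {set V}}) (u v w x y z : V).

Lemma adjC G u v : adj G u v = adj G v u.
Proof. by rewrite /adj setUC. Qed.

Lemma adj_connect_sym G : connect_sym (adj G).
Proof. by apply: sym_connect_sym => u v; rewrite adjC. Qed.

Lemma adj_neq G u v : simple_graph G -> adj G u v -> u != v.
Proof.
move=> /forallP /(_ [set u; v]) /implyP H /H.
by rewrite cards2; case: (u != v).
Qed.

Definition adj_except G u w : rel V :=
  fun a b => adj G a b && ([set a; b] != [set u; w]).

(** The cycle shows that no single edge separates [v] from [w] once uw is deleted, which is what
    makes the deletion recoverable. The vertex [v] is [u] itself or, when [u] has degree 2, its
    other neighbour. *)
Definition good_edge G u w v : Prop :=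
  [/\ adj G u w, (v = u) \/ [/\ degree G u = 2, adj G u v & v != w] &
    exists c : seq V,
      [/\ uniq c, 2 < size c, cycle (adj_except G u w) c, v \in c & w \in c]].

Lemma more_neighbour G u (s : seq V) : size s < degree G u ->
  exists2 z, adj G u z & z \notin s.
Proof.
move=> su; apply/exists_inP; apply: contraLR su.
rewrite negb_exists_in -leqNgt => /forall_inP H.
apply: leq_trans (card_size s); apply: subset_leq_card.
by apply/fintype.subsetP => z /H; rewrite negbK.
Qed.

(** The path misses an end [m] of uw, so it cannot use that edge. *)
Lemma path_except G u w m (a : V) (s : seq V) :
  (m == u) || (m == w) -> m \notin a :: s ->
  path (adj G) a s -> path (adj_except G u w) a s.
Proof.
move=> muw ms; apply: (@sub_in_path _ [pred z | z != m]); last first.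
  by apply/allP => z zs; apply: contraNneq ms => <-.
move=> p q pm qm pq; rewrite /adj_except pq set2_eqE negb_or !negb_and.
move: pm qm; rewrite !inE.
by case/orP: muw => /eqP <- -> ->; rewrite ?orbT.
Qed.

Section LongestPath.
Variables (G : {set {set V}}) (r : V).
Hypothesis simpleG : simple_graph G.

(** The end to be examined is the head of the path, so adding an end vertex is a cons. *)
Definition rooted_path (l : V) (t : seq V) :=
  [&& uniq (l :: t), path (adj G) l t & connect (adj G) r l].

Definition longest (l : V) (t : seq V) :=
  rooted_path l t /\ forall l' t', rooted_path l' t' -> size t' <= size t.

Lemma longest_exists : exists l t, longest l t.
Proof.
pose P n := [exists l : V, exists t : n.-tuple V, rooted_path l t].
have P0 : exists n, P n.
  exists 0; apply/existsP; exists r; apply/existsP; exists [tuple].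
  by rewrite /rooted_path /= connect0.
have Pmax n : P n -> n <= #|V|.
  move=> /existsP[l /existsP[t /and3P[/= /andP[_ tu] _ _]]].
  by rewrite -(size_tuple t) -(card_uniqP tu) max_card.
case: (ex_maxnP P0 Pmax) => n /existsP[l /existsP[t lt]] nmax.
exists l, t; split=> // l' t' lt'; rewrite size_tuple; apply: nmax.
by apply/existsP; exists l'; apply/existsP; exists (in_tuple t').
Qed.

(** A neighbour off the path could be put in front of it. *)
Lemma longest_neighbour l t z : longest l t -> adj G l z -> z \in t.
Proof.
move=> [/and3P[lu lp rl] lmax] lz; apply/negPn/negP => zt.
have : rooted_path z (l :: t).
  apply/and3P; split.
  - by rewrite cons_uniq lu andbT inE negb_or zt eq_sym (adj_neq simpleG lz).
  - by rewrite /= adjC lz.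
  - exact: connect_trans rl (connect1 lz).
by move=> /lmax; rewrite /= ltnn.
Qed.

(** Besides its successor, [l] has two neighbours on the path. The path up to the further one, [b],
    closes to a cycle, of which the edge to the nearer one, [a], is a chord; this chord is good with
    [v] equal to [l]. *)
Lemma longest_chord l t : longest l t -> 2 < degree G l ->
  exists u w v, connect (adj G) r u /\ good_edge G u w v.
Proof.
move=> lt dl; have [/and3P[lu lp rl] _] := lt.
have [[|p1 t'] [lt' p1l]] : exists t', t = t' /\ (t' <> [::]).
  have [|z lz _] := @more_neighbour G l [::]; first exact: leq_trans dl.
  by exists t; split=> // t0; have := longest_neighbour lt lz; rewrite t0.
  by [].
subst t.
have [z1 lz1 z1p] := @more_neighbour G l [:: p1] (ltnW dl).
have [z2 lz2 z2p] := @more_neighbour G l [:: p1; z1] dl.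
suff H a b : adj G l a -> adj G l b -> a != p1 -> b != p1 -> a != b ->
    index a t' <= index b t' ->
    exists u w v, connect (adj G) r u /\ good_edge G u w v.
  move: z1p z2p; rewrite !inE negb_or => z1p /andP[z2p z21].
  have [ab|ba] := leqP (index z1 t') (index z2 t').
    by apply: (H z1 z2) => //; rewrite eq_sym.
  by apply: (H z2 z1) => //; exact: ltnW.
move=> la lb ap bp ab ii.
have bt : b \in t'.
  by have := longest_neighbour lt lb; rewrite inE (negbTE bp).
have lta : index a t' < index b t'.
  rewrite ltn_neqAle ii andbT; apply: contraNneq ab => e.
  have at' : a \in t' by have := longest_neighbour lt la; rewrite inE (negbTE ap).
  by rewrite -(nth_index l at') e nth_index.
case/splitPr: bt lta lu lp lt => s1 s2 lta lu lp _.
move: lta; rewrite !index_cat /= eqxx addn0 => lta.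
have bs1 : b \notin s1.
  by move: lu; rewrite /= cat_uniq /= !mem_cat !inE; case: (b \in s1);
     rewrite ?orbT ?andbF.
have as1 : a \in s1.
  by move: lta; rewrite (negbTE bs1); case: ifP => // _; rewrite ltnNge -{1}[size s1]addn0 leq_add2l.
have cu : uniq (l :: p1 :: rcons s1 b).
  by move: lu; rewrite -cat_rcons -!cat_cons cat_uniq => /andP[].
have l1 : l \notin p1 :: rcons s1 b by case/andP: cu.
exists l, a, l; split=> //; split; [by []|by left|].
exists (l :: p1 :: rcons s1 b); split.
- exact: cu.
- by rewrite /= size_rcons.
- move: lp; rewrite -cat_rcons /= cat_path => /and3P[lp1 ps _].
  rewrite rcons_path; apply/and3P; split.
  + rewrite /adj_except lp1 set2_eqE eqxx (eq_sym p1) (negbTE ap) /=.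
    by rewrite negb_and (adj_neq simpleG la).
  + by apply: (path_except _ l1 ps); rewrite eqxx.
  + rewrite last_rcons /adj_except adjC lb set2_eqE eqxx andbT.
    by rewrite (eq_sym b a) (negbTE ab) orbF negb_and eq_sym (adj_neq simpleG lb).
- by rewrite inE eqxx.
- by rewrite !inE mem_rcons inE as1 !orbT.
Qed.


(** By the previous lemma only an end [l] of degree 2 is left, with neighbours [p1] and [z]. Then
    [p1] has a neighbour [m] that is not next to it on the path, and the good edge depends on where
    [m] lies. *)
Lemma longest_good l t : longest l t ->
  (forall u, connect (adj G) r u -> 1 < degree G u) ->
  (forall u w, connect (adj G) r u -> adj G u w ->
     degree G u = 2 -> degree G w <> 2) ->
  exists u w v, connect (adj G) r u /\ good_edge G u w v.
Proof.
move=> lt deg2 nadj2; have [/and3P[lu lp rl] lmax] := lt.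
have [dl|dl] := ltnP 2 (degree G l); first exact: longest_chord lt dl.
have {}dl : degree G l = 2 by apply/eqP; rewrite eqn_leq dl deg2.
case: t => [|p1 t'] in lt lu lp lmax *.
  have [z lz _] := @more_neighbour G l [::] (ltnW (deg2 l rl)).
  by have := longest_neighbour lt lz.
have lp1 : adj G l p1 by case/andP: lp.
have rp1 : connect (adj G) r p1 := connect_trans rl (connect1 lp1).
have [z lz zp1] := @more_neighbour G l [:: p1] (deg2 l rl).
rewrite inE in zp1.
have zt : z \in t'.
  by have := longest_neighbour lt lz; rewrite inE (negbTE zp1).
have dp1 : 2 < degree G p1.
  by rewrite ltn_neqAle deg2 // andbT eq_sym; apply/eqP/(nadj2 l).
(* [z] is in [t'], so [p2] is the true successor of [p1] and the default of [head] does not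
   occur. *)
pose p2 := head p1 t'.
have [m p1m] := @more_neighbour G p1 [:: l; p2] dp1.
rewrite !inE negb_or => /andP[ml mp2].
have mp1 : m != p1 by rewrite eq_sym (adj_neq simpleG p1m).
have rm : connect (adj G) r m := connect_trans rp1 (connect1 p1m).
rewrite {}/p2 in mp2.
case/splitPr: zt lt lu lp lmax mp2 => s1 s2 lt lu lp lmax mp2.
have cu1 : uniq (l :: p1 :: rcons s1 z).
  by move: lu; rewrite -cat_rcons -!cat_cons cat_uniq => /andP[].
have l1 : l \notin p1 :: rcons s1 z by case/andP: cu1.
have p1s : path (adj G) p1 (s1 ++ z :: s2) by case/andP: lp.
have ps1 : path (adj G) p1 (rcons s1 z).
  by move: p1s; rewrite -cat_rcons cat_path => /andP[].
have zl : adj G z l by rewrite adjC.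
have lp1n : l != p1 := adj_neq simpleG lp1.
have cycle_l k a b : k \notin l :: p1 :: rcons s1 z -> (k == a) || (k == b) ->
    cycle (adj_except G a b) (l :: p1 :: rcons s1 z).
  move=> kn kab; rewrite /cycle.
  apply: (@path_except _ _ _ k) => //.
    by rewrite -rcons_cons mem_rcons inE negb_or kn andbT; case/norP: kn.
  by rewrite /= lp1 rcons_path ps1 last_rcons.
have [mt|mt] := boolP (m \in l :: p1 :: s1 ++ z :: s2).
  have {}mt : m \in s1 ++ z :: s2.
    by move: mt; rewrite !inE (negbTE ml) (negbTE mp1).
  (* If [m] comes no later than [z], the edge from [p1] to [m] is a chord of the cycle that runs
     from [l] along the path to [z]. *)
  have [m1|m1] := boolP (m \in rcons s1 z).
    exists p1, m, p1; split=> //; split; [by []|by left|].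
    exists (l :: p1 :: rcons s1 z); split=> //.
    - by rewrite /= size_rcons.
    - have p1n : p1 \notin rcons s1 z by case/and3P: cu1.
      rewrite /cycle /=; apply/andP; split.
        rewrite /adj_except lp1 set2_eqE eqxx (negbTE lp1n) (eq_sym l).
        by rewrite (negbTE ml).
      rewrite rcons_path last_rcons; apply/andP; split; last first.
        rewrite /adj_except zl set2_eqE (negbTE zp1) (negbTE lp1n).
        by rewrite andbF.
      case: s1 p1n ps1 mp2 {lt lu lp lmax cu1 l1 p1s cycle_l mt m1} =>
        [|p2 s1] /= p1n /andP[p12 ps1] mp2.
        rewrite andbT /adj_except p12 set2_eqE eqxx (eq_sym z m).
        rewrite (negbTE mp2) /=.
        by move: p1n; rewrite inE eq_sym => /negbTE->; rewrite andbF.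
      rewrite /adj_except p12 set2_eqE eqxx (eq_sym p2 m) (negbTE mp2) /=.
      rewrite (eq_sym p2); have p1p2 : p1 != p2 by case/norP: p1n.
      rewrite (negbTE p1p2) andbF /=.
      by apply: (path_except _ p1n ps1); rewrite eqxx.
    - by rewrite !inE eqxx orbT.
    - by rewrite !inE m1 !orbT.
  (* If [m] lies beyond [z], the path from [p1] to [m] closes to a cycle through [z], and the edge
     from [l] to [p1] is good with [z] as third vertex. *)
  have ms2 : m \in s2.
    by move: mt; rewrite -cat_rcons mem_cat (negbTE m1).
  case/splitPr: ms2 lu p1s {lt lp lmax mt mp2} => s3 s4 lu p1s.
  have E : s1 ++ z :: s3 ++ m :: s4 = rcons (s1 ++ z :: s3) m ++ s4.
    by rewrite -cats1 -!catA.
  rewrite E in lu p1s.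
  have cu2 : uniq (l :: p1 :: rcons (s1 ++ z :: s3) m).
    by move: lu; rewrite -!cat_cons cat_uniq => /andP[].
  have ps2 : path (adj G) p1 (rcons (s1 ++ z :: s3) m).
    by move: p1s; rewrite cat_path => /andP[].
  have /andP[l2 cu2'] := cu2.
  exists l, p1, z; split=> //; split; [by []|by right|].
  exists (p1 :: rcons (s1 ++ z :: s3) m); split=> //.
  - by rewrite /= size_rcons size_cat /= addnS.
  - rewrite /cycle; apply: (@path_except _ _ _ l); rewrite ?eqxx //.
      by rewrite -rcons_cons mem_rcons inE negb_or l2 andbT.
    by rewrite rcons_path ps2 last_rcons adjC.
  - by rewrite inE mem_rcons inE mem_cat !inE eqxx !orbT.
  - by rewrite inE eqxx.
(* Off the path, [m] can replace [l] as the end of a longest path. *)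
have {}mt : m \notin p1 :: s1 ++ z :: s2 by case/norP: mt.
have mlong : longest m (p1 :: s1 ++ z :: s2).
  split=> //; apply/and3P; split=> //; last by rewrite /= adjC p1m.
  by rewrite cons_uniq mt; case/andP: lu.
have [dm|dm] := ltnP 2 (degree G m); first exact: longest_chord mlong dm.
have {}dm : degree G m = 2 by apply/eqP; rewrite eqn_leq dm deg2.
have [z' mz' z'p1] := @more_neighbour G m [:: p1] (deg2 m rm).
rewrite inE in z'p1.
have z't : z' \in s1 ++ z :: s2.
  by have := longest_neighbour mlong mz'; rewrite inE (negbTE z'p1).
(* Now [l] and [m] both have degree 2, with second neighbours [z] and [z']. The end whose second
   neighbour is farther along closes a cycle through the second neighbour of the other end, and the
   edge from that other end to [p1] is good. *)
have [z'1|z'1] := boolP (z' \in rcons s1 z).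
  exists m, p1, z'; split=> //; split; [by rewrite adjC|by right|].
  exists (l :: p1 :: rcons s1 z); split=> //.
  - by rewrite /= size_rcons.
  - apply: (cycle_l m); rewrite ?eqxx // inE negb_or ml /=.
    by apply: contra mt; rewrite -cat_rcons !inE mem_cat => /orP[->|->] //; rewrite orbT.
  - by rewrite !inE z'1 !orbT.
  - by rewrite !inE eqxx orbT.
have z's2 : z' \in s2.
  by move: z't; rewrite -cat_rcons mem_cat (negbTE z'1).
case/splitPr: z's2 lu p1s mt {lt lp lmax mp2 mlong z't} => s3 s4 lu p1s mt.
have E : s1 ++ z :: s3 ++ z' :: s4 = rcons (s1 ++ z :: s3) z' ++ s4.
  by rewrite -cats1 -!catA.
rewrite E in lu p1s mt.
have cu2 : uniq (l :: p1 :: rcons (s1 ++ z :: s3) z').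
  by move: lu; rewrite -!cat_cons cat_uniq => /andP[].
have ps2 : path (adj G) p1 (rcons (s1 ++ z :: s3) z').
  by move: p1s; rewrite cat_path => /andP[].
have /andP[l2 cu2'] := cu2.
have m2 : m \notin p1 :: rcons (s1 ++ z :: s3) z'.
  by apply: contra mt; rewrite !inE mem_cat => /orP[->|->] //; rewrite orbT.
exists l, p1, z; split=> //; split; [by []|by right|].
exists (m :: p1 :: rcons (s1 ++ z :: s3) z'); split.
- by rewrite cons_uniq m2.
- by rewrite /= size_rcons size_cat /= addnS.
- rewrite /cycle; apply: (@path_except _ _ _ l); rewrite ?eqxx //.
    by rewrite -rcons_cons mem_rcons !inE !negb_or eq_sym ml /=;
       move: l2; rewrite !inE negb_or.
  by rewrite /= adjC p1m rcons_path ps2 last_rcons adjC.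
- by rewrite !inE mem_rcons inE mem_cat !inE eqxx !orbT.
- by rewrite !inE eqxx orbT.
Qed.

Lemma gadget_exists :
  [\/ exists2 u, connect (adj G) r u & degree G u <= 1,
      exists u w, [/\ connect (adj G) r u, adj G u w, degree G u = 2 &
                      degree G w = 2] |
      exists u w v, connect (adj G) r u /\ good_edge G u w v].
Proof.
have [|H1] := pselect (exists2 u, connect (adj G) r u & degree G u <= 1).
  exact: Or31.
have [|H2] := pselect (exists u w, [/\ connect (adj G) r u, adj G u w,
    degree G u = 2 & degree G w = 2]); first exact: Or32.
have [l [t lt]] := longest_exists.
apply/Or33/(longest_good lt).
  by move=> u ru; rewrite ltnNge; apply/negP => du; apply: H1; exists u.
by move=> u w ru uw du dw; apply: H2; exists u, w.
Qed.

End LongestPath.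
End Gadget.

(** * Switches *)

Local Ltac bool_cases := repeat match goal with
  | |- context [@eq_op ?T ?a ?b] => case: (@eq_op T a b) => //=
  | |- context [adj ?G ?a ?b] => case: (adj G a b) => //=
  end.

(** * Degrees, components and planarity under a switch *)

Section SwitchCombinatorics.
Local Open Scope nat_scope.
Local Open Scope set_scope.
Variable V : finType.
Implicit Types (G : {set {set V}}) (u v w x y z : V) (b : bool).

Lemma connect_ind_l (e : rel V) u w (P : V -> Prop) : connect e u w -> P u ->
  (forall p q, connect e u p -> P p -> e p q -> P q) -> P w.
Proof.
move=> /connectP[s us ->] Pu Pstep.
elim/last_ind: s us => [|s q IH] //.
rewrite rcons_path last_rcons => /andP[us sq].
by apply: Pstep sq; [apply/connectP; exists s|exact: IH].
Qed.

Lemma degree_ge_uniq G u (s : seq V) :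
  uniq s -> all (adj G u) s -> size s <= degree G u.
Proof.
move=> us /allP su; rewrite -(card_uniqP us); apply: subset_leq_card.
by apply/fintype.subsetP => z /su.
Qed.

Lemma degree2_neighbours G u w v z : degree G u = 2 -> adj G u w ->
  adj G u v -> v != w -> adj G u z -> z = w \/ z = v.
Proof.
move=> du uw uv vw uz; have [->|zw] := eqVneq z w; first by left.
have [->|zv] := eqVneq z v; first by right.
have := @degree_ge_uniq G u [:: z; v; w]; rewrite /= !inE negb_or zv zw vw /=.
by rewrite uw uv uz du => /(_ isT isT).
Qed.

Lemma degree0_adj G u z : degree G u = 0 -> adj G u z = false.
Proof.
move=> du; apply/negP => uz; have := @degree_ge_uniq G u [:: z] isT.
by rewrite /= uz du => /(_ isT).
Qed.

Lemma degree1_adj G u w z : degree G u <= 1 -> adj G u w -> adj G u z -> z = w.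
Proof.
move=> du uw uz; apply/eqP; apply: contraTT du => zw; rewrite -ltnNge.
by apply: (@degree_ge_uniq G u [:: z; w]); rewrite /= ?inE ?zw ?uw ?uz.
Qed.

Lemma adj_switch b u w x y G p q : adj (switch b u w x y G) p q =
  [|| (p == u) && (q == x), (p == x) && (q == u),
      (p == w) && (q == y), (p == y) && (q == w) |
    [&& adj G p q, ~~ ((p == x) && (q == y) || (p == y) && (q == x)) &
        b ==> ~~ ((p == u) && (q == w) || (p == w) && (q == u))]].
Proof. by rewrite /adj in_switch !set2_eqE !orbA. Qed.

(** Inverse of the switch. The test for x = y keeps a singleton from being put back as if it had
    been an edge. *)
Definition unswitch b u w x y G : {set {set V}} :=
  (G :\: [set [set u; x]; [set w; y]]) :|:
  ((if x == y then set0 else [set [set x; y]]) :|: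
   (if b then [set [set u; w]] else set0)).

(* In the case [SwitchIsolated], [set x; y] is a singleton and hence not an edge,
   and the switch just adds the edge ux. *)
Inductive switch_kind G b u w x y : Prop :=
| SwitchLeaf of b = false & w = u & degree G u <= 1 & adj G x y
| SwitchIsolated of b = false & w = u & x = y & degree G u = 0 & degree G x = 0
| SwitchPair of b = false & adj G u w & degree G u = 2 & degree G w = 2 &
    adj G x y
| SwitchCut of b = true & adj G u w & connect (adj_except G u w) u w &
    adj G x y.

Definition switchable G b u w x y :=
  [/\ simple_graph G, ~~ connect (adj G) u x & switch_kind G b u w x y].

(** At a vertex of degree [d], [m] neighbours are gained and [n] lost; either these numbers agree or
    the new degree is at most 3. *)
Lemma switch_degree_arith (d d' m n : nat) : d' + n = d + m ->
  (n == m) || (n <= m) && (d + m <= 3 + n) -> d <= d' <= maxn 3 d.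
Proof. by move=> e /orP[/eqP nm|/andP[nm d3]]; lia. Qed.

Lemma degree_modify G H z (A B : {set V}) :
  (forall t, adj H z t = (t \in A) || (adj G z t && (t \notin B))) ->
  (forall t, t \in A -> adj G z t = false) ->
  (forall t, t \in B -> adj G z t) ->
  degree H z + #|B| = degree G z + #|A|.
Proof.
move=> HE GA GB; pose N := [set t | adj G z t].
have -> : degree H z = #|A :|: (N :\: B)|.
  by rewrite /degree; apply: eq_card => t; rewrite !inE -topredE /= HE andbC.
have -> : degree G z = #|N|.
  by rewrite /degree; apply: eq_card => t; rewrite inE -topredE.
have BN : B \subset N by apply/fintype.subsetP => t /GB; rewrite inE.
have dis : A :&: (N :\: B) = set0.
  apply/setP => t; rewrite !inE; have [/GA->|] //= := boolP (t \in A).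
  by rewrite andbF.
rewrite cardsU dis cards0 subn0 cardsD (setIidPr BN).
by have := subset_leq_card BN; lia.
Qed.

Definition comp G u : {set V} := [set v | connect (adj G) u v].
Definition comps G : {set {set V}} := [set comp G u | u : V].
Definition ncomp G := #|comps G|.

Lemma eq_comp G u v : (comp G u == comp G v) = connect (adj G) u v.
Proof.
apply/eqP/idP => [e|uv].
  have : v \in comp G v by rewrite inE connect0.
  by rewrite -e inE.
by apply/setP => t; rewrite !inE (same_connect (adj_connect_sym G) uv).
Qed.

Lemma comp_in_comps G u : comp G u \in comps G.
Proof. exact: imset_f. Qed.

Lemma closed_comp_set G u : closed_set G (comp G u).
Proof.
move=> p q pq; rewrite !inE; apply/idP/idP => h; apply: connect_trans h _.
  exact: connect1.
by apply: connect1; rewrite adjC.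
Qed.

Section Switchable.
Variables (G : {set {set V}}) (b : bool) (u w x y : V).
Hypothesis sw : switchable G b u w x y.
Let G' := switch b u w x y G.
Let simpleG : simple_graph G. Proof. by case: sw. Qed.
Let nux : ~~ connect (adj G) u x. Proof. by case: sw. Qed.

Lemma switchable_uw : connect (adj G) u w.
Proof. by case: sw => _ _ [_ -> *|_ -> *|_ /connect1|_ /connect1]. Qed.

Lemma switchable_xy : connect (adj G) x y.
Proof. by case: sw => _ _ [_ _ _ /connect1|_ _ -> *|_ _ _ _ /connect1|_ _ _ /connect1]. Qed.

(** The two vertices lie in different components. The facts are bundled as a product so that one
    rewrite rule covers them all. *)
Let cross p q : connect (adj G) u p -> connect (adj G) x q ->
  (p == q = false) * (q == p = false) * (adj G p q = false) *
  (adj G q p = false).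
Proof.
move=> up xq.
have npq : ~~ connect (adj G) p q.
  apply: contra nux => pq; apply: connect_trans up _.
  by apply: connect_trans pq _; rewrite adj_connect_sym.
have e : (p == q) = false by apply: contraNF npq => /eqP->.
have a : adj G p q = false by apply: contraNF npq => /connect1.
by rewrite (eq_sym q p) (adjC G q p) e a.
Qed.

Let uu : connect (adj G) u u := connect0 _ _.
Let xx : connect (adj G) x x := connect0 _ _.
Let uw := switchable_uw.
Let xy := switchable_xy.

Lemma switch_simple : simple_graph G'.
Proof.
apply/forallP => e; apply/implyP; rewrite in_switch.
case/or3P=> [/eqP->|/eqP->|/andP[eG _]].
- by rewrite cards2 (cross uu xx).
- by rewrite cards2 (cross uw xy).
- by have /forallP /(_ e) /implyP := simpleG; apply.
Qed.

(** The added edges ux and wy join different components, so they were not in [G], while the sets put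
    back were edges of [G]. *)
Lemma switchK : unswitch b u w x y G' = G.
Proof.
have nG p q : connect (adj G) u p -> connect (adj G) x q ->
    ([set p; q] \in G) = false.
  by move=> up xq; have := cross up xq; rewrite /adj => -[[_ ->]].
have nself p : ([set p; p] \in G) = false.
  by apply: contraTF isT => pp; have := adj_neq simpleG pp; rewrite eqxx.
have xyE : ([set x; y] \in G) = (x != y).
  have [<-|nxy] := eqVneq x y; first exact: nself.
  by case: sw => _ _ [] // _ _ e; rewrite e eqxx in nxy.
have uwE : b -> [set u; w] \in G by case: sw => _ _ [] // ->.
have remG e : e \in (if x == y then set0 else [set [set x; y]]) :|:
    (if b then [set [set u; w]] else set0) -> e \in G.
  rewrite in_setU => /orP[]; case: ifP => // h; rewrite inE // => /eqP->.
    by rewrite xyE h.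
  exact: uwE.
apply/setP => e; rewrite /unswitch in_setU in_setD in_switch.
have [eA|eA] := boolP (e \in [set [set u; x]; [set w; y]]).
  have eG : e \notin G by move: eA; rewrite !inE => /orP[]/eqP->; rewrite nG.
  by rewrite (negbTE eG); apply/negbTE; apply: contra eG; exact: remG.
move: eA; rewrite in_set2 negb_or => /andP[/negbTE-> /negbTE->] /=.
have [eR|eR] := boolP (e \in _ :|: _); first by rewrite orbT remG.
rewrite orbF; have [eG|] := boolP (e \in G) => //=.
move: eR; rewrite in_setU negb_or => /andP[e1 e2]; apply/andP; split.
  move: e1; case: ifP => [/eqP<- _|_]; last by rewrite inE.
  by apply: contraTneq eG => ->; rewrite nself.
by apply/implyP => bT; move: e2; rewrite bT inE.
Qed.

(** An end that loses an old neighbour gains exactly one new one. Degrees grow only at an end of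
    degree at most 1 gaining at most two neighbours, or at an end of degree 2 gaining one. *)
Lemma switch_degree z :
  degree G z <= degree G' z <= maxn 3 (degree G z).
Proof.
have ux := cross uu xx; have uy := cross uu xy.
have wx := cross uw xx; have wy := cross uw xy.
have same : z != u -> z != w -> z != x -> z != y ->
    degree G z <= degree G' z <= maxn 3 (degree G z).
  move=> /negbTE zu /negbTE zw /negbTE zx /negbTE zy.
  have := @degree_modify G G' z set0 set0; rewrite !cards0 !addn0 => ->.
  - by rewrite leqnn leq_max leqnn orbT.
  - by move=> t; rewrite adj_switch !inE zu zw zx zy /= implybT !andbT.
  - by move=> t; rewrite inE.
  - by move=> t; rewrite inE.
have fin (A B : {set V}) : degree G' z + #|B| = degree G z + #|A| ->
    (#|B| == #|A|) || (#|B| <= #|A|) && (degree G z + #|A| <= 3 + #|B|) ->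
    degree G z <= degree G' z <= maxn 3 (degree G z).
  exact: switch_degree_arith.
case: sw => _ _ [bF wu du axy|bF wu xy' du dx|bF auw du dw axy|bT auw _ axy].
- have nxy := adj_neq simpleG axy; have nyx := nxy; rewrite eq_sym in nyx.
  move: nxy nyx => /negbTE nxy /negbTE nyx.
  have [zu|zu] := eqVneq z u.
    apply: (@fin [set x; y] set0); last first.
      by rewrite cards0 cards2 nxy zu /= addn2 addn0 !ltnS.
    rewrite zu; apply: degree_modify => t.
    + rewrite adj_switch bF wu !inE eqxx !ux !uy /=; bool_cases.
    + by rewrite !inE => /orP[]/eqP->; rewrite (ux, uy).
    + by rewrite inE.
  have [zx|zx] := eqVneq z x.
    apply: (@fin [set u] [set y]); last by rewrite !cards1.
    rewrite zx; apply: degree_modify => t.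
    + rewrite adj_switch bF wu !inE eqxx !ux nxy /=; bool_cases.
    + by rewrite !inE => /eqP->; rewrite ux.
    + by rewrite inE => /eqP->.
  have [zy|zy] := eqVneq z y.
    apply: (@fin [set u] [set x]); last by rewrite !cards1.
    rewrite zy; apply: degree_modify => t.
    + rewrite adj_switch bF wu !inE eqxx !uy nyx /=; bool_cases.
    + by rewrite !inE => /eqP->; rewrite uy.
    + by rewrite inE => /eqP->; rewrite adjC.
  by apply: same; rewrite ?wu.
- have [zu|zu] := eqVneq z u.
    apply: (@fin [set x] set0); last by rewrite cards0 cards1 zu du.
    rewrite zu; apply: degree_modify => t.
    + rewrite adj_switch bF wu -xy' !inE eqxx !ux /=; bool_cases.
    + by rewrite !inE => /eqP->; rewrite ux.
    + by rewrite inE.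
  have [zx|zx] := eqVneq z x.
    apply: (@fin [set u] set0); last by rewrite cards0 cards1 zx dx.
    rewrite zx; apply: degree_modify => t.
    + rewrite adj_switch bF wu -xy' !inE eqxx !ux (degree0_adj _ dx) /=.
      bool_cases.
    + by rewrite !inE => /eqP->; rewrite ux.
    + by rewrite inE.
  by apply: same; rewrite ?wu -?xy'.
- have nxy := adj_neq simpleG axy; have nyx := nxy; rewrite eq_sym in nyx.
  have nuw := adj_neq simpleG auw; have nwu := nuw; rewrite eq_sym in nwu.
  move: nxy nyx nuw nwu => /negbTE nxy /negbTE nyx /negbTE nuw /negbTE nwu.
  have [zu|zu] := eqVneq z u.
    apply: (@fin [set x] set0); last by rewrite cards0 cards1 zu du.
    rewrite zu; apply: degree_modify => t.
    + rewrite adj_switch bF !inE eqxx !ux !uy nuw /=; bool_cases.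
    + by rewrite !inE => /eqP->; rewrite ux.
    + by rewrite inE.
  have [zw|zw] := eqVneq z w.
    apply: (@fin [set y] set0); last by rewrite cards0 cards1 zw dw.
    rewrite zw; apply: degree_modify => t.
    + rewrite adj_switch bF !inE eqxx !wx !wy nwu /=; bool_cases.
    + by rewrite !inE => /eqP->; rewrite wy.
    + by rewrite inE.
  have [zx|zx] := eqVneq z x.
    apply: (@fin [set u] [set y]); last by rewrite !cards1.
    rewrite zx; apply: degree_modify => t.
    + rewrite adj_switch bF !inE eqxx !ux !wx nxy /=; bool_cases.
    + by rewrite !inE => /eqP->; rewrite ux.
    + by rewrite inE => /eqP->.
  have [zy|zy] := eqVneq z y.
    apply: (@fin [set w] [set x]); last by rewrite !cards1.
    rewrite zy; apply: degree_modify => t.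
    + rewrite adj_switch bF !inE eqxx !uy !wy nyx /=; bool_cases.
    + by rewrite !inE => /eqP->; rewrite wy.
    + by rewrite inE => /eqP->; rewrite adjC.
  exact: same.
- have nxy := adj_neq simpleG axy; have nyx := nxy; rewrite eq_sym in nyx.
  have nuw := adj_neq simpleG auw; have nwu := nuw; rewrite eq_sym in nwu.
  move: nxy nyx nuw nwu => /negbTE nxy /negbTE nyx /negbTE nuw /negbTE nwu.
  have [zu|zu] := eqVneq z u.
    apply: (@fin [set x] [set w]); last by rewrite !cards1.
    rewrite zu; apply: degree_modify => t.
    + rewrite adj_switch bT !inE eqxx !ux !uy nuw /=; bool_cases.
    + by rewrite !inE => /eqP->; rewrite ux.
    + by rewrite inE => /eqP->.
  have [zw|zw] := eqVneq z w.
    apply: (@fin [set y] [set u]); last by rewrite !cards1.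
    rewrite zw; apply: degree_modify => t.
    + rewrite adj_switch bT !inE eqxx !wx !wy nwu /=; bool_cases.
    + by rewrite !inE => /eqP->; rewrite wy.
    + by rewrite inE => /eqP->; rewrite adjC.
  have [zx|zx] := eqVneq z x.
    apply: (@fin [set u] [set y]); last by rewrite !cards1.
    rewrite zx; apply: degree_modify => t.
    + rewrite adj_switch bT !inE eqxx !ux !wx nxy /=; bool_cases.
    + by rewrite !inE => /eqP->; rewrite ux.
    + by rewrite inE => /eqP->.
  have [zy|zy] := eqVneq z y.
    apply: (@fin [set w] [set x]); last by rewrite !cards1.
    rewrite zy; apply: degree_modify => t.
    + rewrite adj_switch bT !inE eqxx !uy !wy nyx /=; bool_cases.
    + by rewrite !inE => /eqP->; rewrite wy.
    + by rewrite inE => /eqP->; rewrite adjC.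
  exact: same.
Qed.

(** The deleted edges are bypassed. [u] and [w] coincide, keep their edge, or are joined by another
    path, which stays in their component and so avoids xy; then [x] and [y] are joined through [u]
    and [w]. *)
Lemma sub_connect_switch : subrel (connect (adj G)) (connect (adj G')).
Proof.
have ux' : connect (adj G') u x by apply: connect1; rewrite adj_switch !eqxx.
have wy' : connect (adj G') w y.
  by apply: connect1; rewrite adj_switch !eqxx !orbT.
have key : connect (adj G') u w.
  case: sw => _ _ [_ -> *|_ -> *|bF auw *|bT auw cuw axy].
  - exact: connect0.
  - exact: connect0.
  - apply: connect1; rewrite adj_switch bF auw (cross uu xx) (cross uu xy) /=.
    by rewrite !orbT.
  - apply: (connect_ind_l (P := connect (adj G') u) cuw (connect0 _ _)).
    move=> p q up IH /andP[pq pquw]; apply: connect_trans IH (connect1 _).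
    have up' : connect (adj G) u p.
      by apply: connect_sub up => c d /andP[cd _]; exact: connect1.
    have e : ([set p; q] == [set x; y]) = false.
      by rewrite set2_eqE !(cross up' xx) !(cross up' xy).
    by rewrite adj_switch pq -!set2_eqE pquw e implybT !orbT.
have xy' : connect (adj G') x y.
  apply: connect_trans (connect_trans key wy').
  by rewrite adj_connect_sym.
apply: connect_sub => p q pq.
have [e1|e1] := eqVneq [set p; q] [set x; y].
  move/eqP: e1; rewrite set2_eqE => /orP[]/andP[/eqP-> /eqP->] //.
  by rewrite adj_connect_sym.
have [e2|e2] := eqVneq [set p; q] [set u; w].
  move/eqP: e2; rewrite set2_eqE => /orP[]/andP[/eqP-> /eqP->] //.
  by rewrite adj_connect_sym.
by apply: connect1; rewrite adj_switch pq -!set2_eqE e1 e2 implybT !orbT.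
Qed.

(** Every edge that is new in [G'] has both ends in [D], the union of the components of [u] and
    [x]. *)
Lemma connect_switch p q : connect (adj G') p q =
  connect (adj G) p q ||
  ((connect (adj G) u p || connect (adj G) x p) &&
   (connect (adj G) u q || connect (adj G) x q)).
Proof.
have symG := adj_connect_sym G.
apply/idP/idP => [pq|/orP[|/andP[pD qD]]]; last 2 first.
- exact: sub_connect_switch.
- have ux' : connect (adj G') u x by apply: connect1; rewrite adj_switch !eqxx.
  have uD t : connect (adj G) u t || connect (adj G) x t -> connect (adj G') u t.
    by case/orP => /sub_connect_switch // ; exact: connect_trans.
  by apply: connect_trans (uD q qD); rewrite adj_connect_sym uD.
pose D t := connect (adj G) u t || connect (adj G) x t.
have Dstep s t : D s -> connect (adj G) s t -> D t.
  by move=> /orP[us|xs] st; apply/orP; [left|right]; exact: connect_trans st.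
apply: (connect_ind_l (P := fun q => connect (adj G) p q || D p && D q) pq).
  by rewrite connect0.
have [Du Dx Dw Dy] : [/\ D u, D x, D w & D y].
  by rewrite /D uu xx uw xy !orbT.
have extend s t : D s -> D t -> connect (adj G) p s || D p && D s ->
    connect (adj G) p t || D p && D t.
  move=> Ds Dt /orP[ps|/andP[-> _]]; last by rewrite Dt orbT.
  by rewrite Dt (Dstep s p Ds) ?orbT // symG.
move=> s t _ IH; rewrite adj_switch => /or4P[|||/orP[]].
- by case/andP => /eqP e1 /eqP e2; move: IH; rewrite e1 e2; exact: extend.
- by case/andP => /eqP e1 /eqP e2; move: IH; rewrite e1 e2; exact: extend.
- by case/andP => /eqP e1 /eqP e2; move: IH; rewrite e1 e2; exact: extend.
- by case/andP => /eqP e1 /eqP e2; move: IH; rewrite e1 e2; exact: extend.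
case/andP => /connect1 st _; case/orP: IH => [ps|/andP[Dp Ds]].
  by rewrite (connect_trans ps st).
by rewrite Dp (Dstep s t) ?orbT.
Qed.

Lemma ncomp_switch : ncomp G = (ncomp G').+1.
Proof.
pose D := comp G u :|: comp G x.
have compE p : comp G' p = if p \in D then D else comp G p.
  apply/setP => t; rewrite inE connect_switch; case: ifP; rewrite !inE => pD;
    rewrite pD ?orbF //=.
  case/orP: pD => pD; rewrite -!(same_connect (adj_connect_sym G) pD).
    by rewrite orbA orbb.
  by rewrite orbCA orbb.
have ncux : comp G u != comp G x by rewrite eq_comp.
have DG : D \notin comps G.
  apply/imsetP => -[p _ Dp].
  have pu : u \in comp G p by rewrite -Dp !inE uu.
  have px : x \in comp G p by rewrite -Dp !inE xx orbT.
  case/negP: nux; move: pu px; rewrite !inE => pu; apply: connect_trans.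
  by rewrite adj_connect_sym.
have compsE : comps G' = D |: (comps G :\ comp G u :\ comp G x).
  apply/setP => S; rewrite !inE; apply/imsetP/idP.
    move=> [p _ ->]; rewrite compE; case: ifP => pD; first by rewrite eqxx.
    rewrite comp_in_comps andbT !eq_comp; apply/orP; right.
    by move: pD; rewrite !inE !(adj_connect_sym G p) => /norP[-> ->].
  case/predU1P => [->|/and3P[Sx Su /imsetP[p _ Sp]]].
    by exists u => //; rewrite compE !inE uu.
  exists p => //; rewrite compE ifN // !inE negb_or.
  by rewrite ![connect _ _ p]adj_connect_sym -!eq_comp -!Sp Su Sx.
rewrite /ncomp compsE cardsU1 !inE (negbTE DG) !andbF /=.
rewrite (cardsD1 (comp G u) (comps G)) comp_in_comps.
rewrite (cardsD1 (comp G x) (comps G :\ comp G u)) !inE comp_in_comps.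
by rewrite andbT eq_sym ncux.
Qed.

(** Each kind of switch has its own surgery; a vertex of degree at most 1 is treated as a leaf or as
    an isolated vertex. *)
Lemma switch_planar (R : realType) : planar R G -> planar R G'.
Proof.
move=> Gp; have uC : u \in comp G u by rewrite inE.
have xC : x \notin comp G u by rewrite inE.
have yC : y \notin comp G u.
  by rewrite inE; apply: contra nux => uy; apply: connect_trans uy _;
     rewrite adj_connect_sym.
have GC := @closed_comp_set G u.
rewrite /G'; case: sw => _ _ [-> -> du axy|-> -> <- du dx|-> auw du dw axy|-> auw _ axy].
- have [[w' uw']|H] := pselect (exists w', adj G u w').
    apply: (planar_switch_leaf Gp GC uC xC yC axy (w := w')) => //.
      by rewrite eq_sym (adj_neq simpleG uw').
    by move=> b' ub'; exact: degree1_adj du uw' ub'.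
  apply: planar_switch_isolated => // b'; apply/negP => ub'.
  by apply: H; exists b'.
- apply: planar_join_isolated => //.
  + by rewrite (cross uu xx).
  + by move=> b'; have := degree0_adj b' du; rewrite /adj => ->.
  + by move=> b'; have := degree0_adj b' dx; rewrite /adj => ->.
- have awu : adj G w u by rewrite adjC.
  have [v uv vw] : exists2 v, adj G u v & v \notin [:: w].
    by apply: more_neighbour; rewrite du.
  have [v' wv' v'u] : exists2 v', adj G w v' & v' \notin [:: u].
    by apply: more_neighbour; rewrite dw.
  rewrite !inE in vw v'u.
  apply: (planar_switch_pair Gp GC uC xC yC axy (v := v) (v' := v')) => //.
  + exact: adj_neq simpleG auw.
  + by rewrite eq_sym (adj_neq simpleG uv).
  + by rewrite eq_sym (adj_neq simpleG wv').
  + by move=> c uc; exact: degree2_neighbours du auw uv vw uc.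
  + by move=> c wc; exact: degree2_neighbours dw awu wv' v'u wc.
- exact: planar_switch_cut Gp GC uC xC yC axy auw.
Qed.

End Switchable.
End SwitchCombinatorics.

(** * Recovering a cut from the switched graph *)

Section Recover.
Local Open Scope nat_scope.
Local Open Scope set_scope.
Variable V : finType.
Implicit Types (G : {set {set V}}) (X Y : {set V}) (u v w x y z : V).

(* Both cuts have a single edge.  As [v] and [w2] cannot be separated by one
   edge, [w2] lies in [X1], and conversely; unless the two edges agree, each of
   them then stays inside the other cut, so that nothing leaves the union. *)
Lemma cut_edge_unique (H : rel V) v x X1 X2 w1 y1 w2 y2 :
  v \in X1 -> x \notin X1 -> w1 \in X1 -> y1 \notin X1 -> H w1 y1 ->
  v \in X2 -> x \notin X2 -> w2 \in X2 -> y2 \notin X2 -> H w2 y2 ->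
  (forall a b, a \in X1 -> b \notin X1 -> H a b -> a = w1 /\ b = y1) ->
  (forall a b, a \in X2 -> b \notin X2 -> H a b -> a = w2 /\ b = y2) ->
  (forall Y w, w = w1 \/ w = w2 -> v \in Y -> w \notin Y -> forall a0 b0,
     exists a b, [/\ a \in Y, b \notin Y, H a b & (a, b) <> (a0, b0)]) ->
  connect H v x -> w1 = w2 /\ y1 = y2.
Proof.
move=> v1 x1 w11 y11 h1 v2 x2 w22 y22 h2 cut1 cut2 two vx.
have w21 : w2 \in X1.
  apply/negPn/negP => w21.
  have [a [b [aX bX ab nab]]] := two X1 w2 (or_intror erefl) v1 w21 w1 y1.
  by apply: nab; have [-> ->] := cut1 a b aX bX ab.
have w12 : w1 \in X2.
  apply/negPn/negP => w12.
  have [a [b [aX bX ab nab]]] := two X2 w1 (or_introl erefl) v2 w12 w2 y2.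
  by apply: nab; have [-> ->] := cut2 a b aX bX ab.
have [y12|y12] := boolP (y1 \in X2); last exact: cut2 w12 y12 h1.
have [y21|y21] := boolP (y2 \in X1); last first.
  by have [-> ->] := cut1 _ _ w21 y21 h2.
suff : x \in X1 :|: X2 by rewrite inE (negbTE x1) (negbTE x2).
apply: (connect_ind_l (P := fun z => z \in X1 :|: X2) vx).
  by rewrite inE v1.
move=> a b _ aX ab; rewrite inE; apply/negPn/negP => /norP[b1 b2].
move: aX; rewrite inE => /orP[a1|a2].
  by have [_ e] := cut1 a b a1 b1 ab; rewrite e y12 in b2.
by have [_ e] := cut2 a b a2 b2 ab; rewrite e y21 in b1.
Qed.

Lemma path_crossing (e : rel V) Y a (s : seq V) : path e a s -> a \in Y ->
  last a s \notin Y -> exists s1 p q s2,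
    [/\ a :: s = s1 ++ p :: q :: s2, p \in Y, q \notin Y & e p q].
Proof.
elim: s a => [|b s IH] a /=; first by move=> _ ->.
move=> /andP[ab bs] aY lY; have [bY|bY] := boolP (b \in Y); last first.
  by exists [::], a, b, s.
have [s1 [p [q [s2 [-> pY qY pq]]]]] := IH b bs bY lY.
by exists (a :: s1), p, q, s2.
Qed.

(** The vertices [v] and [w] split the cycle into two arcs, one leaving [Y] and one returning. If
    both crossings were the same edge, its ends would lie on both arcs and hence be [v] and [w], so
    the cycle would have length 2. *)
Lemma cycle_crossings (e : rel V) Y (c : seq V) v w a0 b0 :
  symmetric e -> cycle e c -> uniq c -> 2 < size c ->
  v \in c -> w \in c -> v \in Y -> w \notin Y ->
  exists a b, [/\ a \in Y, b \notin Y, e a b & (a, b) <> (a0, b0)].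
Proof.
move=> esym cc cu c2 vc wc vY wY.
have [i c' cE] := rot_to vc.
have {}wc : w \in c'.
  have : w \in v :: c' by rewrite -cE mem_rot.
  by rewrite inE => /predU1P[e1|//]; rewrite e1 vY in wY.
case/splitPr: wc cE => c1 d cE.
have {}cc : path e v (rcons (c1 ++ w :: d) v).
  by move: cc; rewrite -(rot_cycle i) cE.
have {}cu : uniq (v :: c1 ++ w :: d) by rewrite -cE rot_uniq.
have {c2} size2 : 2 < size (v :: c1 ++ w :: d) by rewrite -cE size_rot.
have p1 : path e v (rcons c1 w).
  by move: cc; rewrite -cat_rcons rcons_cat cat_path => /andP[].
have p2 : path e w (rcons d v).
  by move: cc; rewrite rcons_cat cat_path /= => /and3P[].
have [s1 [p [q [s2 [E pY qY pq]]]]] :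
    exists s1 p q s2, [/\ v :: rcons c1 w = s1 ++ p :: q :: s2,
      p \in Y, q \notin Y & e p q].
  by apply: path_crossing p1 vY _; rewrite last_rcons.
have [||t1 [p' [q' [t2 [E' p'Y q'Y pq']]]]] := @path_crossing e (~: Y) _ _ p2.
- by rewrite inE.
- by rewrite last_rcons inE negbK.
rewrite inE in p'Y; rewrite inE negbK in q'Y.
have [e1|e1] := pselect ((p, q) = (a0, b0)); last by exists p, q.
have [e2|e2] := pselect ((q', p') = (a0, b0)); last first.
  by exists q', p'; split=> //; rewrite esym.
move: e2; rewrite -e1 => -[qp pq_]; subst p' q'.
have vw : v != w by apply: contraTneq vY => ->.
move: cu; rewrite /= mem_cat inE !negb_or (negbTE vw) /= cat_uniq /= negb_or.
case/andP=> /andP[vc1 vd] /and3P[uc1 /andP[wc1 c1d] /andP[wd ud]].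
have pv : p = v.
  have : p \in v :: rcons c1 w by rewrite E mem_cat !inE eqxx orbT.
  have : p \in w :: rcons d v by rewrite E' mem_cat !inE eqxx !orbT.
  have pw : p != w by apply: contraTneq pY => ->.
  rewrite !inE !mem_rcons !inE (negbTE pw) /=.
  case: eqP => //= _ pd pc1; case/negP: c1d; apply/hasP; exists p => //.
have qw : q = w.
  have : q \in v :: rcons c1 w by rewrite E mem_cat !inE eqxx !orbT.
  have : q \in w :: rcons d v by rewrite E' mem_cat !inE eqxx orbT.
  have qv : q != v by apply: contraNneq qY => ->.
  rewrite !inE !mem_rcons !inE (negbTE qv) /=.
  case: eqP => //= _ qd qc1; case/negP: c1d; apply/hasP; exists q => //.
subst p q.
have ends a b (r1 r2 r : seq V) : a \notin rcons r b -> b \notin r ->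
    a :: rcons r b = r1 ++ a :: b :: r2 -> r = [::].
  move=> ar br; case: r1 => [[]|_ r1 [_ F]]; last first.
    by move: ar; rewrite F mem_cat inE eqxx orbT.
  by case: r ar br => [//|r0 r] /= _ br [F _]; rewrite F inE eqxx in br.
have c10 : c1 = [::].
  by apply: (ends v w s1 s2) => //; rewrite mem_rcons inE negb_or vw.
have d0 : d = [::].
  by apply: (ends w v t1 t2) => //; rewrite mem_rcons inE negb_or eq_sym vw.
by move: size2; rewrite c10 d0.
Qed.

Lemma adj_except_sym G u w : symmetric (adj_except G u w).
Proof. by move=> a b; rewrite /adj_except adjC (setUC [set a]). Qed.

Lemma connect_except G u w a b :
  connect (adj_except G u w) a b -> connect (adj G) a b.
Proof. by apply: connect_sub => c d /andP[cd _]; exact: connect1. Qed.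

Section Token.
Variables (G : {set {set V}}) (u w x y v : V).
Hypothesis sw : switchable G true u w x y.
Hypothesis good : good_edge G u w v.
Hypothesis nbridge : connect (adj_except G x y) x y.
Let G' := switch true u w x y G.
(** With ux removed as well, wy is the only edge left that leaves the component [X] of [u] in [G],
    so it separates [v] from [x]. *)
Let H := adj_except G' u x.
Let X := comp G u.

Let simpleG : simple_graph G. Proof. by case: sw. Qed.
Let nux : ~~ connect (adj G) u x. Proof. by case: sw. Qed.
Let uw : connect (adj G) u w := switchable_uw sw.
Let xy : connect (adj G) x y := switchable_xy sw.

Let uv : connect (adj G) u v.
Proof. by case: good => _ [->|[_ /connect1]]. Qed.

Let nin p : connect (adj G) x p -> p \notin X.
Proof.
move=> xp; rewrite inE; apply: contra nux => up; apply: connect_trans up _.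
by rewrite adj_connect_sym.
Qed.

Let keep_l a b : a \in X -> adj_except G u w a b -> H a b.
Proof.
move=> aX /andP[ab abuw]; have aX' := aX; rewrite inE in aX'.
have bX : b \in X by rewrite inE; exact: connect_trans aX' (connect1 ab).
have ne p q : q \notin X -> ([set a; b] == [set p; q]) = false.
  move=> qX; apply/negP => /eqP E; case/negP: qX.
  have : q \in [set a; b] by rewrite E !inE eqxx orbT.
  by rewrite !inE => /orP[]/eqP->; move: aX bX; rewrite !inE.
rewrite /H /adj_except adj_switch ab -!set2_eqE abuw.
by rewrite (ne u x (nin (connect0 _ _))) (ne x y (nin xy)) !orbT.
Qed.

Let keep_r a b : connect (adj G) x a -> adj_except G x y a b -> H a b.
Proof.
move=> xa /andP[ab abxy].
have xb : connect (adj G) x b := connect_trans xa (connect1 ab).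
have ne p q : p \in X -> ([set a; b] == [set p; q]) = false.
  move=> pX; apply/negP => /eqP E.
  have : p \in [set a; b] by rewrite E !inE eqxx.
  rewrite !inE => /orP[]/eqP e; move: pX; apply/negP; rewrite e; exact: nin.
rewrite /H /adj_except adj_switch ab -!set2_eqE abxy.
have uX : u \in X by rewrite inE.
by rewrite !(ne u) // !orbT.
Qed.

Lemma switch_cut_edge : [/\ v \in X, x \notin X, w \in X & y \notin X] /\ H w y.
Proof.
split; first by split; rewrite ?nin // inE.
rewrite /H /adj_except adj_switch !eqxx !orbT /= set2_eqE.
have -> : (w == u) = false.
  by case: good => uw' _ _; rewrite eq_sym; exact/negbTE/(adj_neq simpleG).
have -> : (y == u) = false; last by rewrite andbF.
by apply/negbTE; apply: contraNneq (nin xy) => ->; rewrite inE.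
Qed.

Lemma switch_cut_single a b : a \in X -> b \notin X -> H a b -> a = w /\ b = y.
Proof.
move=> aX bX /andP[]; rewrite adj_switch => /or4P[|||/orP[]].
- by case/andP => /eqP-> /eqP->; rewrite eqxx.
- by case/andP => /eqP e _; case/negP: (nin (connect0 (adj G) x)); rewrite -e.
- by case/andP => /eqP-> /eqP->.
- by case/andP => /eqP e _; case/negP: (nin xy); rewrite -e.
- case/andP => ab _ _; case/negP: bX; move: aX; rewrite !inE => ua.
  exact: connect_trans ua (connect1 ab).
Qed.

Let cycle_in_X : exists c : seq V, [/\ uniq c, 2 < size c,
  cycle (adj_except G u w) c, v \in c & w \in c] /\ {subset c <= X}.
Proof.
case: good => _ _ [c [cu cs cc vc wc]]; exists c; split; first by split.
move=> z zc; rewrite inE; apply: connect_trans uv _; apply: (@connect_except G u w).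
have [p s E] := rot_to vc.
have zs : z \in v :: s by rewrite -E mem_rot.
have : path (adj_except G u w) v s.
  by move: cc; rewrite -(rot_cycle p) E /= rcons_path => /andP[].
by move=> vs; exact: (path_connect vs zs).
Qed.

(** The cycle of the good edge lies inside [X] and survives in [H]; it crosses the boundary of [Y]
    twice. *)
Lemma switch_cut_double Y : v \in Y -> w \notin Y -> forall a0 b0,
  exists a b, [/\ a \in Y, b \notin Y, H a b & (a, b) <> (a0, b0)].
Proof.
move=> vY wY a0 b0; have [c [[cu cs cc vc wc] cX]] := cycle_in_X.
pose e := [rel a b | adj_except G u w a b && (a \in X) && (b \in X)].
have esym : symmetric e.
  by move=> a b; rewrite /= adj_except_sym; case: (a \in X); case: (b \in X);
    rewrite ?andbT ?andbF.
have ce : cycle e c.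
  apply: (@sub_in_cycle _ [in X] (adj_except G u w)) => //; last first.
    by apply/allP => z /cX.
  by move=> a b aX bX /= ->; rewrite [a \in X]aX [b \in X]bX.
have [a [b [aY bY /andP[/andP[ab aX] _] nab]]] :=
  cycle_crossings a0 b0 esym ce cu cs vc wc vY wY.
by exists a, b; split=> //; exact: keep_l.
Qed.

(** The route goes from [v] to [w] along the cycle, over the new edge wy, and from [y] back to [x]
    in the other component, where xy is not a bridge. *)
Lemma switch_cut_connect : connect H v x.
Proof.
have [vX xX wX yX] := switch_cut_edge.1.
have vw : connect H v w.
  have [c [[cu cs cc vc wc] cX]] := cycle_in_X.
  have [p s E] := rot_to vc.
  have wE : w \in v :: s by rewrite -E mem_rot.
  have vs : path (adj_except G u w) v s.
    by move: cc; rewrite -(rot_cycle p) E /= rcons_path => /andP[].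
  have Hs : path H v s.
    apply: (@sub_in_path _ [in X] (adj_except G u w)) vs.
      by move=> a b aX _; exact: keep_l.
    by apply/allP => z; rewrite -E mem_rot => /cX.
  exact: path_connect Hs w wE.
apply: connect_trans vw (connect_trans (connect1 switch_cut_edge.2) _).
have Hsym : connect_sym H.
  by apply: sym_connect_sym => a b; exact: adj_except_sym.
rewrite Hsym; apply: (connect_ind_l (P := connect H x) nbridge (connect0 _ _)).
move=> p q xp IH pq; apply: connect_trans IH (connect1 _).
by apply: keep_r pq; exact: connect_except xp.
Qed.

End Token.

(** Both histories give a cut of the same graph between [v] and [x] that consists of one edge. By
    [cut_edge_unique] these edges coincide, so [u], [v] and [x] suffice to recover [w] and [y]. *)
Lemma switch_cut_recover G1 G2 u x v w1 y1 w2 y2 :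
  switchable G1 true u w1 x y1 -> good_edge G1 u w1 v ->
  connect (adj_except G1 x y1) x y1 ->
  switchable G2 true u w2 x y2 -> good_edge G2 u w2 v ->
  connect (adj_except G2 x y2) x y2 ->
  switch true u w1 x y1 G1 = switch true u w2 x y2 G2 -> w1 = w2 /\ y1 = y2.
Proof.
move=> sw1 good1 nb1 sw2 good2 nb2 e.
have [[v1 x1 w11 y11] h1] := switch_cut_edge sw1 good1.
have [[v2 x2 w22 y22] h2] := switch_cut_edge sw2 good2.
have cut1 := @switch_cut_single _ _ _ _ _ sw1.
have cut2 := @switch_cut_single _ _ _ _ _ sw2.
have two1 := switch_cut_double sw1 good1.
have two2 := switch_cut_double sw2 good2.
have vx := switch_cut_connect sw1 good1 nb1.
rewrite -e in h2 cut2 two2.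
apply: (cut_edge_unique v1 x1 w11 y11 h1 v2 x2 w22 y22 h2 cut1 cut2 _ vx).
by move=> Y w [->|->]; [exact: two1|exact: two2].
Qed.

End Recover.

(** * Counting *)

Section WeightedCount.
Local Open Scope nat_scope.

(** A token of G gets weight a / [wa G], so the tokens of G together weigh at least m. Steps inject
    tokens into codes, and a code of H receives at most ab / [wb H], so the codes of H together
    receive at most abc. The weights make up for token and code numbers that vary with the graph. *)
Lemma weighted_double_count (A B T D : finType) (SA : {set A}) (SB : {set B})
    (tok : A -> {set T}) (adm : B -> {set D}) (step : A -> T -> B -> D -> Prop)
    (wa : A -> nat) (wb : B -> nat) (m a b c : nat) :
  (forall G, G \in SA -> 0 < wa G /\ m * wa G <= a * #|tok G|) ->
  (forall G t, G \in SA -> t \in tok G -> exists H d, step G t H d) ->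
  (forall G t H d, G \in SA -> step G t H d ->
     [/\ H \in SB, d \in adm H, 0 < wb H & wb H <= b * wa G]) ->
  (forall G t G' t' H d, step G t H d -> step G' t' H d ->
     G = G' /\ t = t') ->
  (forall H, H \in SB -> #|adm H| <= c * wb H) ->
  m * #|SA| <= a * b * c * #|SB|.
Proof.
move=> tokP stepE stepP stepI admP.
pose S := [set x : A * T | (x.1 \in SA) && (x.2 \in tok x.1)].
(* Without tokens the claim is trivial; otherwise one token supplies the default value for the
   choice function [F]. *)
have [S0|[[G0 t0] GS0]] := set_0Vmem S.
  have tok0 G : G \in SA -> #|tok G| = 0.
    move=> GA; apply/eqP; rewrite cards_eq0; apply/eqP/setP => t.
    rewrite inE; apply/negP => tG.
    by have := in_set0 (G, t); rewrite -S0 inE GA tG.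
  have [->|[G GA]] := set_0Vmem SA; first by rewrite cards0 muln0.
  have [w0] := tokP G GA; rewrite tok0 // muln0 leqn0 muln_eq0 => /orP[/eqP->|].
    by [].
  by rewrite eqn0Ngt w0.
have [H0 [d0 _]] : exists H d, step G0 t0 H d.
  by move: GS0; rewrite inE => /andP[]; exact: stepE.
have /choice[F FP] : forall x : A * T, exists y : B * D,
    x \in S -> step x.1 x.2 y.1 y.2.
  move=> [G t]; have [|nS] := boolP ((G, t) \in S); last by exists (H0, d0).
  rewrite inE => /andP[GA tG]; have [H [d st]] := stepE G t GA tG.
  by exists (H, d).
have Finj : {in S &, injective F}.
  move=> [G t] [G' t'] xS x'S e; have s1 := FP _ xS.
  have s2 := FP _ x'S; rewrite -e in s2.
  by have [/= -> ->] := stepI _ _ _ _ _ _ s1 s2.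
have wpos G : G \in SA -> (0 < (wa G)%:R :> rat)%R.
  by move=> /tokP[w0 _]; rewrite ltr0n.
suff : (m%:R * #|SA|%:R <= (a * b * c)%:R * #|SB|%:R :> rat)%R.
  by rewrite -!natrM ler_nat.
have step1 : (m%:R * #|SA|%:R <=
    \sum_(x in S) a%:R / (wa x.1)%:R :> rat)%R.
  rewrite -[#|SA|]sum1_card natr_sum mulr_sumr.
  have -> : (\sum_(x in S) a%:R / (wa x.1)%:R = \sum_(G in SA) \sum_(t in tok G)
      a%:R / (wa G)%:R :> rat)%R.
    rewrite pair_big_dep /=; apply: eq_bigl => x; by rewrite inE.
  apply: ler_sum => G GA; rewrite mulr1 sumr_const.
  rewrite -[leRHS]mulr_natr mulrAC ler_pdivlMr ?wpos //.
  by rewrite -!natrM ler_nat; have [] := tokP G GA.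
apply: (le_trans step1).
have step2 : (\sum_(x in S) a%:R / (wa x.1)%:R <=
    \sum_(x in S) (a * b)%:R / (wb (F x).1)%:R :> rat)%R.
  apply: ler_sum => x xS; have xA : x.1 \in SA by move: xS; rewrite inE => /andP[].
  have [HB _ w0 wle] := stepP _ _ _ _ xA (FP _ xS).
  rewrite ler_pdivrMr ?wpos // mulrAC ler_pdivlMr ?ltr0n //.
  by rewrite -!natrM ler_nat -mulnA leq_mul2l wle orbT.
apply: (le_trans step2).
rewrite -(big_imset (fun y : B * D => (a * b)%:R / (wb y.1)%:R : rat)%R Finj) /=.
have step3 : (\sum_(y in F @: S) (a * b)%:R / (wb y.1)%:R <=
    \sum_(y | (y.1 \in SB) && (y.2 \in adm y.1)) (a * b)%:R / (wb y.1)%:R :> rat)%R.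
  rewrite [leRHS](bigID (mem (F @: S))) /=.
  rewrite (eq_bigl (fun y => (y.1 \in SB) && (y.2 \in adm y.1) && (y \in F @: S))).
    by rewrite lerDl; apply: sumr_ge0 => y _; rewrite divr_ge0 ?ler0n.
  move=> y; apply/idP/idP => [|/andP[]//]; move=> yF; rewrite yF andbT.
  have /imsetP[x xS ->] := yF.
  have xA : x.1 \in SA by move: xS; rewrite inE => /andP[].
  by have [-> -> _ _] := stepP _ _ _ _ xA (FP _ xS).
apply: (le_trans step3).
rewrite -(pair_big_dep (fun H => H \in SB) (fun H d => d \in adm H)
  (fun H d => (a * b)%:R / (wb H)%:R : rat)%R) /=.
rewrite -[#|SB|]sum1_card natr_sum mulr_sumr.
apply: ler_sum => H HB; rewrite mulr1 sumr_const.
have [->|w0] := posnP (wb H).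
  by rewrite invr0 mulr0 mul0rn ler0n.
rewrite -[leLHS]mulr_natr mulrAC ler_pdivrMr ?ltr0n //.
by rewrite -!natrM ler_nat -[X in _ <= X]mulnA leq_mul2l admP ?orbT.
Qed.

End WeightedCount.

(** * Bridges and their number *)

Section Bridges.
Local Open Scope nat_scope.
Local Open Scope set_scope.
Variable V : finType.
Implicit Types (G : {set {set V}}) (C : {set V}) (p q z : V).

Definition is_bridge G p q := adj G p q && ~~ connect (adj_except G p q) p q.

Lemma adj_exceptC G p q : adj_except G p q = adj_except G q p.
Proof. by apply/funext => a; apply/funext => b; rewrite /adj_except [[set p; q]]setUC. Qed.

Lemma connect_except_sym G p q : connect_sym (adj_except G p q).
Proof. by apply: sym_connect_sym => a b; exact: adj_except_sym. Qed.

Lemma is_bridgeC G p q : is_bridge G p q = is_bridge G q p.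
Proof. by rewrite /is_bridge adjC adj_exceptC connect_except_sym. Qed.

(* Seen from the root of its component, the near end of a bridge is the only
   neighbour of the far end from which the root can be reached avoiding the far
   end. *)
Definition bridge_parent G q : V :=
  odflt q [pick z | adj G q z &&
    connect [rel a b | [&& adj G a b, a != q & b != q]] z (fingraph.root (adj G) q)].

(** A simple path from [q] to the root provides a neighbour of the required sort. A neighbour other
    than [p] with that property would join [q] to the root, and hence to [p], without the edge
    pq. *)
Lemma bridge_parentE G p q : simple_graph G -> is_bridge G p q ->
  connect (adj_except G p q) (fingraph.root (adj G) q) p -> bridge_parent G q = p.
Proof.
move=> simpleG /andP[pq npq] rp.
set r := fingraph.root (adj G) q in rp *; set e := adj_except G p q in npq rp.
have esym := connect_except_sym G p q.
have rq : ~~ connect e r q.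
  by apply: contra npq => rq; apply: connect_trans rq; rewrite esym.
have qr : connect (adj G) q r := connect_root _ _.
have [s qs er] := connectP qr.
case/shortenP: qs er => s' qs us _ er.
rewrite /bridge_parent -/r; case: pickP => [z /andP[qz zr]|] /=.
  apply/eqP; apply: contraNT rq => zp.
  rewrite esym; apply: connect_trans (connect1 _) _; last first.
    apply: connect_sub zr => a b /and3P[ab aq bq]; apply: connect1.
    by rewrite /e /adj_except ab set2_eqE (negbTE aq) (negbTE bq) !andbF.
  rewrite /e /adj_except qz set2_eqE (negbTE zp) /= andbF orbF.
  by rewrite negb_and eq_sym (adj_neq simpleG pq).
case: s' qs us er => [_ _ er|z s' /= /andP[qz zs] /andP[qn us] er].
  by case/negP: rq; rewrite er connect0.
move=> /(_ z); rewrite qz /= => /negP; case.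
rewrite er; apply/connectP; exists s' => //.
apply: (@sub_in_path _ [pred a | a != q] (adj G)) zs.
  by move=> a b; rewrite !inE /= => aq bq ab; rewrite ab aq bq.
by apply/allP => a az; apply: contraNneq qn => <-.
Qed.

(** Along a walk from [q] to the root, each step either uses pq, and so lands at one of its ends, or
    keeps the vertex joined to an end without pq. *)
Lemma bridge_orient G p q : is_bridge G p q ->
  connect (adj_except G p q) (fingraph.root (adj G) q) p \/
  connect (adj_except G p q) (fingraph.root (adj G) q) q.
Proof.
move=> /andP[pq _]; have qr : connect (adj G) q (fingraph.root (adj G) q).
  exact: connect_root.
set e := adj_except G p q; have esym : connect_sym e by exact: connect_except_sym.
apply: (connect_ind_l (P := fun t => connect e t p \/ connect e t q) qr).
  by right; exact: connect0.
move=> a b _ IH ab; have [E|E] := eqVneq [set a; b] [set p; q].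
  by move/eqP: E; rewrite set2_eqE => /orP[]/andP[_ /eqP->]; [right|left];
     exact: connect0.
have ba : connect e b a by rewrite esym; apply: connect1; rewrite /e /adj_except ab.
by case: IH => IH; [left|right]; exact: connect_trans ba IH.
Qed.

(** Each vertex with a neighbour is the far end of at most one bridge, which counts twice as an
    ordered pair. *)
Lemma card_bridges G C : simple_graph G -> closed_set G C ->
  #|[set a : V * V | (a.1 \notin C) && is_bridge G a.1 a.2]| <=
  2 * #|[set p | (p \notin C) && (0 < degree G p)]|.
Proof.
move=> simpleG GC; set N := [set p | _].
apply: (@leq_trans #|[set (bridge_parent G q, q) | q in N] :|:
                     [set (p, bridge_parent G p) | p in N]|); last first.
  apply: leq_trans (leq_card_setU _ _) _; rewrite mul2n -addnn.
  by apply: leq_add; exact: leq_imset_card.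
apply: subset_leq_card; apply/fintype.subsetP => -[p q]; rewrite !inE /= => /andP[pC pq].
have apq : adj G p q by case/andP: pq.
have dpos s t : adj G s t -> 0 < degree G s.
  by move=> st; apply: (@degree_ge_uniq _ G s [:: t]); rewrite //= st.
have pN : p \in N by rewrite inE pC (dpos p q).
have qN : q \in N by rewrite inE -(GC p q apq) pC (dpos q p) // adjC.
apply/orP; have [rp|rq] := bridge_orient pq.
  by left; apply/imsetP; exists q => //; rewrite (bridge_parentE simpleG pq rp).
have qp : is_bridge G q p by rewrite is_bridgeC.
right; apply/imsetP; exists p => //; rewrite (bridge_parentE simpleG qp) //.
rewrite adj_exceptC (_ : fingraph.root _ p = fingraph.root (adj G) q) //.
by apply/(fingraph.rootP (adj_connect_sym G)); exact: connect1.
Qed.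

Lemma sum_degree G (P : pred V) : \sum_(p | P p) degree G p =
  #|[set a : V * V | P a.1 && adj G a.1 a.2]|.
Proof.
rewrite -sum1_card (eq_bigr (fun p => \sum_(q | adj G p q) 1)).
  rewrite pair_big_dep /=; apply: eq_bigl => a; by rewrite inE.
by move=> p _; rewrite sum1_card.
Qed.

(* With s ordered edges, nb of them not bridges, m of them joining vertices of
   degree 2, and n1 vertices of degree 1, one has s <= 6 nb + 8 n1 + m. *)
Lemma pendant_arith (s nb B n n1 n2 n3 i m : nat) :
  s = B + nb -> B <= 2 * n -> n = n1 + n2 + n3 ->
  n1 + 2 * n2 + 3 * n3 <= s -> nb <= i -> n1 <= i -> m <= i ->
  4 * n2 <= m + s -> s <= 15 * i.
Proof. by lia. Qed.

(** The pairs that can be combined with a good edge in [C]: an edge that is not a bridge takes part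
    in a cut, while a vertex of degree 1, written as a diagonal pair, or an edge between vertices of
    degree 2 is used with the roles of the components exchanged. *)
Definition pendant_items G C : {set V * V} := [set a : V * V |
  (a.1 \notin C) &&
  [|| adj G a.1 a.2 && ~~ is_bridge G a.1 a.2,
      (a.1 == a.2) && (degree G a.1 == 1) |
      [&& adj G a.1 a.2, degree G a.1 == 2 & degree G a.2 == 2]]].

(** If few edges outside [C] are not bridges, the average degree of the non-isolated vertices there
    is hardly above 2, so vertices of degree 1 or edges between vertices of degree 2 abound. *)
Lemma card_pendant_items G C : simple_graph G -> closed_set G C ->
  \sum_(p | p \notin C) degree G p <= 15 * #|pendant_items G C|.
Proof.
move=> simpleG GC; set I := pendant_items G C.
pose A := [set a : V * V | (a.1 \notin C) && adj G a.1 a.2].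
pose B := [set a : V * V | (a.1 \notin C) && is_bridge G a.1 a.2].
pose N (P : pred nat) := [set p | (p \notin C) && P (degree G p)].
pose A2 := [set a in A | degree G a.1 == 2].
pose M := [set a in A2 | degree G a.2 == 2].
have NE (P : pred nat) : #|N P| = \sum_(p | p \notin C) P (degree G p).
  rewrite -sum1dep_card big_mkcondr /=; apply: eq_bigr => p _.
  by case: (P _).
have sA : \sum_(p | p \notin C) degree G p = #|A| by exact: sum_degree.
have BA : B \subset A.
  by apply/fintype.subsetP => a; rewrite !inE => /andP[-> /andP[]].
have cA2 : #|A2| = 2 * #|N (pred1 2)|.
  have -> : A2 = [set a : V * V |
      ((a.1 \notin C) && (degree G a.1 == 2)) && adj G a.1 a.2].
    by apply/setP => a; rewrite !inE andbAC.
  rewrite -(sum_degree G (fun p => (p \notin C) && (degree G p == 2))).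
  rewrite (eq_bigr (fun=> 2)); last by move=> p /andP[_ /eqP].
  by rewrite sum_nat_const mulnC cardsE.
(* Reversing an edge from a vertex of degree 2 to one of another degree gives an edge in [A] but not
   in [A2]. *)
have cM : #|A2| <= #|M| + (#|A| - #|A2|).
  have MA2 : M \subset A2 by apply/fintype.subsetP => a; rewrite inE => /andP[].
  have A2A : A2 \subset A by apply/fintype.subsetP => a; rewrite inE => /andP[].
  rewrite -cardsDS // -(subnKC (subset_leq_card MA2)) leq_add2l -cardsDS //.
  pose f (a : V * V) := (a.2, a.1).
  have finj : injective f by move=> [a b] [c d] [-> ->].
  rewrite -(card_imset _ finj); apply: subset_leq_card.
  apply/fintype.subsetP => _ /imsetP[[p q] pq ->]; move: pq.
  rewrite !inE /= => /andP[H /andP[/andP[pC pq] dp]].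
  by rewrite adjC pq -(GC p q pq) pC /= andbT; move: H; rewrite pC pq dp.
apply: (@pendant_arith _ #|A :\: B| #|B| #|N (ltn 0)| #|N (pred1 1)|
  #|N (pred1 2)| #|N (ltn 2)| _ #|M|).
- by rewrite sA -(cardsID B A) (setIidPr BA).
- exact: card_bridges.
- rewrite !NE -!big_split /=; apply: eq_bigr => p _.
  by case: (degree G p) => [|[|[|d]]].
- rewrite !NE !big_distrr -!big_split /=; apply: leq_sum => p _.
  by case: (degree G p) => [|[|[|d]]].
- apply: subset_leq_card; apply/fintype.subsetP => a; rewrite !inE.
  by case/andP=> nb /andP[aC aa]; move: nb; rewrite aC aa /= => ->.
- have dinj : injective (fun p : V => (p, p)) by move=> a b [].
  rewrite -(card_imset _ dinj); apply: subset_leq_card.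
  apply/fintype.subsetP => a /imsetP[p]; rewrite inE => /andP[pC /= dp] ->.
  by rewrite inE /= pC eqxx dp orbT.
- apply: subset_leq_card; apply/fintype.subsetP => a; rewrite !inE.
  by case/andP=> /andP[/andP[-> ->] ->] ->; rewrite !orbT.
- have : #|A2| <= #|A|.
    by apply: subset_leq_card; apply/fintype.subsetP => a; rewrite inE => /andP[].
  move: cM; rewrite sA cA2; move: #|A| #|M| #|N _| => ? ? ?; clear; lia.
Qed.

End Bridges.

(** * Tokens, codes and the ratio of consecutive component numbers *)

Section Tokens.
Local Open Scope nat_scope.
Local Open Scope set_scope.
Variable V : finType.
Implicit Types (G H : {set {set V}}) (C : {set V}) (u v w x y p q : V).

(** Number of vertices plus twice the number of edges of a simple graph, to which the numbers of
    tokens and codes are compared. *)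
Definition weight G := \sum_(v : V) (degree G v).+1.

Lemma weightE G : weight G = #|V| + \sum_(v : V) degree G v.
Proof.
rewrite /weight -sum1_card -big_split /=.
by apply: eq_bigr => v _; rewrite add1n.
Qed.

(* The first component of a code records which of the three rules was used. *)
Inductive step G : {set V} * (V * V) -> {set {set V}} ->
    option bool * (V * V * V * V) -> Prop :=
| StepDirect u w p q of switchable G false u w p q :
    step G (comp G u, (p, q)) (switch false u w p q G)
         (Some false, (u, w, p, q))
| StepSwapped p q x y of switchable G false p q x y :
    step G (comp G x, (p, q)) (switch false p q x y G)
         (Some true, (p, q, x, y))
| StepCut u w v p q of switchable G true u w p q & good_edge G u w v &
    connect (adj_except G p q) p q :
    step G (comp G u, (p, q)) (switch true u w p q G) (None, (u, v, p, p)).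

(** The tag of the code fixes the rule. In the first two rules the code lists all four vertices and
    the switch can be undone; in a cut the two missing vertices are recovered first. *)
Lemma step_inj G t G' t' H d : step G t H d -> step G' t' H d ->
  G = G' /\ t = t'.
Proof.
case=> [u w p q sw|p q x y sw|u w v p q sw good nb] s2.
- inversion s2 as [u' w' p' q' sw' E1 E2 E3| |]; subst.
  have E : G = G' by rewrite -(switchK sw) -(switchK sw') E2.
  by subst G'.
- inversion s2 as [|p' q' x' y' sw' E1 E2 E3|]; subst.
  have E : G = G' by rewrite -(switchK sw) -(switchK sw') E2.
  by subst G'.
- inversion s2 as [| |u' w' v' p' q' sw' good' nb' E1 E2 E3]; subst.
  have [e1 e2] := switch_cut_recover sw good nb sw' good' nb' (esym E2).
  subst w' q'.
  have E : G = G' by rewrite -(switchK sw) -(switchK sw') E2.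
  by subst G'.
Qed.

(** Three indices name all neighbours of a vertex of degree at most 3; an index beyond the degree
    gives [u] itself. *)
Definition near_vertex H u (i : 'I_3) : V := nth u (enum (adj H u)) i.

Lemma near_vertexP H u x : degree H u <= 3 -> adj H u x ->
  exists i, x = near_vertex H u i.
Proof.
move=> du ux; have xu : x \in enum (adj H u) by rewrite mem_enum.
have lt3 : index x (enum (adj H u)) < 3.
  by apply: leq_trans du; rewrite /degree cardE index_mem.
by exists (Ordinal lt3); rewrite /near_vertex nth_index.
Qed.

(** The four families are: u = w, with x and y next to u; a pair, with w and x next to u and y next
    to w; a cut with v = u, given by the edge ux; and a cut with v other than u, with v and x next
    to u. Only the third may meet a vertex of large degree, and it is counted by the degree sum. *)
Definition codes H : {set option bool * (V * V * V * V)} :=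
  [set (Some a.1.1.1, (a.1.1.2, a.1.1.2, near_vertex H a.1.1.2 a.1.2,
        near_vertex H a.1.1.2 a.2)) | a : bool * V * 'I_3 * 'I_3] :|:
  [set (Some a.1.1.1.1, (a.1.1.1.2, near_vertex H a.1.1.1.2 a.1.1.2,
        near_vertex H a.1.1.1.2 a.1.2,
        near_vertex H (near_vertex H a.1.1.1.2 a.1.1.2) a.2)) |
      a : bool * V * 'I_3 * 'I_3 * 'I_3] :|:
  [set (None, (a.1, a.1, a.2, a.2)) |
      a in [set a : V * V | predT a.1 && adj H a.1 a.2]] :|:
  [set (None, (a.1.1, near_vertex H a.1.1 a.1.2, near_vertex H a.1.1 a.2,
        near_vertex H a.1.1 a.2)) | a : V * 'I_3 * 'I_3].

Lemma card_codes H : #|codes H| <= 81 * weight H.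
Proof.
rewrite weightE; rewrite /codes.
apply: (@leq_trans (#|V| * 18 + #|V| * 54 + \sum_(v : V) degree H v + #|V| * 9)); last by lia.
apply: leq_trans (leq_card_setU _ _) _; apply: leq_add; last first.
  by apply: leq_trans (leq_imset_card _ _) _; rewrite !card_prod !card_ord -mulnA.
apply: leq_trans (leq_card_setU _ _) _; apply: leq_add; last first.
  by apply: leq_trans (leq_imset_card _ _) _; rewrite -(sum_degree H predT).
apply: leq_trans (leq_card_setU _ _) _; apply: leq_add.
  apply: leq_trans (leq_imset_card _ _) _.
  by rewrite !card_prod !card_ord card_bool; lia.
apply: leq_trans (leq_imset_card _ _) _.
by rewrite !card_prod !card_ord card_bool; lia.
Qed.

Lemma switch_in_codes G b u w x y : switchable G false u w x y ->
  (Some b, (u, w, x, y)) \in codes (switch false u w x y G).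
Proof.
move=> sw; set H := switch false u w x y G.
have ux : adj H u x by rewrite adj_switch !eqxx.
have wy : adj H w y by rewrite adj_switch !eqxx !orbT.
have deg3 z : degree G z <= 3 -> degree H z <= 3.
  move=> dz; have /andP[_] := switch_degree sw z.
  by rewrite (maxn_idPl dz).
have leaf : w = u -> degree G u <= 3 -> (Some b, (u, w, x, y)) \in codes H.
  move=> e /deg3 du; subst w.
  have [i ->] := near_vertexP du ux; have [j ->] := near_vertexP du wy.
  rewrite /codes 3!in_setU; apply/orP; left; apply/orP; left; apply/orP; left.
  by apply/imsetP; exists (b, u, i, j).
case: (sw) => simpleG nux [_ e du _|_ e _ du _|_ auw du dw axy|//].
- by apply: leaf => //; apply: leq_trans du _.
- by apply: leaf; rewrite ?du.
have auw' : adj H u w.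
  rewrite adj_switch auw /= andbT.
  have -> : (u == x) = false by apply: contraNF nux => /eqP->.
  have -> : (u == y) = false; last by rewrite !orbT.
  apply: contraNF nux => /eqP->; rewrite adj_connect_sym; exact: connect1.
have du' : degree H u <= 3 by apply: deg3; rewrite du.
have dw' : degree H w <= 3 by apply: deg3; rewrite dw.
have [i wE] := near_vertexP du' auw'; have [j xE] := near_vertexP du' ux.
have [k yE] := near_vertexP dw' wy.
rewrite /codes 3!in_setU; apply/orP; left; apply/orP; left; apply/orP; right.
by apply/imsetP; exists (b, u, i, j, k) => //=; rewrite -wE -xE -yE.
Qed.

Lemma step_codes G t H d : step G t H d -> d \in codes H.
Proof.
case=> [u w p q sw|p q x y sw|u w v p q sw good _];
  [exact: switch_in_codes|exact: switch_in_codes|].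
set H' := switch true u w p q G.
have up : adj H' u p by rewrite adj_switch !eqxx.
case: (sw) => simpleG nup _; case: good => auw [->|[du auv vw]] _.
  rewrite /codes 2!in_setU; apply/orP; left; apply/orP; right.
  by apply/imsetP; exists (u, p) => //; rewrite inE.
have du' : degree H' u <= 3.
  by have /andP[_] := switch_degree sw u; rewrite du.
have auv' : adj H' u v.
  rewrite adj_switch auv eqxx (negbTE vw) (negbTE (adj_neq simpleG auw)) /=.
  have -> : (u == p) = false by apply: contraNF nup => /eqP->.
  have -> : (u == q) = false; last by rewrite !orbT.
  apply: contraNF nup => /eqP->; rewrite adj_connect_sym.
  exact: switchable_xy sw.
have [i vE] := near_vertexP du' auv'; have [j pE] := near_vertexP du' up.
rewrite /codes in_setU; apply/orP; right.
by apply/imsetP; exists (u, i, j) => //=; rewrite -vE -pE.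
Qed.

(** The factor 4 is attained by an isolated vertex whose degree rises to the bound 3. *)
Lemma weight_switch G b u w x y : switchable G b u w x y ->
  weight (switch b u w x y G) <= 4 * weight G.
Proof.
move=> sw; rewrite /weight big_distrr /=; apply: leq_sum => z _.
have /andP[_ dz] := switch_degree sw z.
apply: (@leq_trans (maxn 3 (degree G z)).+1) => //; lia.
Qed.

Definition tokens G : {set {set V} * (V * V)} :=
  [set t | `[< exists H d, step G t H d >]].

(** Meant for k + 2 components, [n] vertices, [i] of them isolated, degree sum [s] and [T] tokens.
    From n <= i + s and k + 1 < n one gets (k + 1) i <= i (i - 1) + s i, and s i <= 2 (k + 1) s. *)
Lemma token_arith (k n s i T : nat) : n <= i + s -> k.+1 < n -> i <= k.+2 ->
  k.+1 * s + i * (i - 1) <= 15 * T -> k.+1 * (n + s) <= 60 * T.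
Proof.
move=> nis kn ik H.
suff : k.+1 * (n + s) <= 4 * (k.+1 * s + i * (i - 1)) by lia.
case: i => [|i] in nis ik H *; first by nia.
have h1 : k.+1 * n <= k.+1 * (i.+1 + s) by rewrite leq_mul2l nis orbT.
have h2 : k.+1 * i.+1 <= (i + s) * i.+1 by rewrite leq_mul2r; apply/orP; right; lia.
have h3 : s * i.+1 <= s * (2 * k.+1) by rewrite leq_mul2l; apply/orP; right; lia.
rewrite subn1 /=; nia.
Qed.

Section Count.
Variable G : {set {set V}}.
Hypothesis simpleG : simple_graph G.

Definition isolated : {set V} := [set v | degree G v == 0].

Lemma isolated_adj v z : v \in isolated -> adj G v z = false.
Proof. by rewrite inE => /eqP; exact: degree0_adj. Qed.

Lemma isolated_connect v z : v \in isolated -> connect (adj G) v z -> z = v.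
Proof.
move=> vi vz; apply: (connect_ind_l (P := fun z => z = v) vz) => // p q _ ->.
by rewrite isolated_adj.
Qed.

(** The cycle joins [v] to [w] without uw, and [v] is [u] or is joined to it by another edge. *)
Lemma good_edge_connect u w v : good_edge G u w v ->
  connect (adj_except G u w) u w.
Proof.
move=> [auw uv [c [cu cs cc vc wc]]].
have vw : connect (adj_except G u w) v w.
  have [i s E] := rot_to vc.
  have ws : w \in v :: s by rewrite -E mem_rot.
  have vs : path (adj_except G u w) v s.
    by move: cc; rewrite -(rot_cycle i) E /= rcons_path => /andP[].
  exact: path_connect vs w ws.
case: uv => [vu|[_ auv nvw]]; first by move: vw; rewrite vu.
apply: connect_trans vw; apply: connect1.
rewrite /adj_except auv set2_eqE (negbTE nvw) andbF /=.
by rewrite (negbTE (adj_neq simpleG auw)).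
Qed.

(** An isolated vertex, a leaf or an adjacent pair of degree 2 in [C] can be combined with every
    ordered edge outside [C], and a good edge with every pendant item. An isolated vertex can
    moreover be joined to any other one, which matters when edges are scarce. *)
Lemma tokens_comp C : C \in comps G ->
  \sum_(p | p \notin C) degree G p +
  (if C \in comp G @: isolated then #|isolated| - 1 else 0) <=
  15 * #|[set a | (C, a) \in tokens G]|.
Proof.
move=> CG; set T := [set a | _].
pose A := [set a : V * V | (a.1 \notin C) && adj G a.1 a.2].
have sA : \sum_(p | p \notin C) degree G p = #|A| by exact: sum_degree.
have direct u w p q : C = comp G u -> switchable G false u w p q -> (p, q) \in T.
  move=> CE sw; rewrite !inE; apply/asboolP; rewrite CE.
  by exists (switch false u w p q G); eexists; exact: StepDirect.
case: ifP => [/imsetP[r ri Cr]|_].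
  have nrp p : p \notin C -> ~~ connect (adj G) r p by rewrite Cr inE.
  have dr : degree G r = 0 by move: ri; rewrite inE => /eqP.
  (* Diagonal pairs stand for joining [r] to another isolated vertex; they differ from all ordered
     edges of a simple graph. *)
  pose D := [set (p, p) | p in isolated :\ r].
  have cD : #|D| = #|isolated| - 1.
    rewrite card_imset; last by move=> a b [].
    by rewrite (cardsD1 r isolated) ri add1n subn1.
  have AD : A :&: D = set0.
    apply/setP => a; rewrite in_set0; apply/negP => /setIP[aA /imsetP[p _ ap]].
    move: aA; rewrite ap inE => /andP[_] /= /(adj_neq simpleG).
    by rewrite eqxx.
  rewrite sA -cD; apply: (@leq_trans #|T|); last by rewrite leq_pmull.
  rewrite -cardsUI AD cards0 addn0; apply: subset_leq_card.
  apply/fintype.subsetP => -[p q]; rewrite in_setU => /orP[|/imsetP[z]].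
    rewrite inE /= => /andP[pC pq]; apply: (direct r r) => //.
    by split=> //; [exact: nrp|apply: SwitchLeaf; rewrite ?dr].
  move=> zi [-> ->]; apply: (direct r r) => //.
  move: zi; rewrite !inE => /andP[zr /eqP dz].
  split=> //; last exact: SwitchIsolated.
  by apply: contra zr => /(isolated_connect ri) ->.
rewrite addn0; have [r _ Cr] := imsetP CG.
have inC u : connect (adj G) r u -> C = comp G u.
  by move=> ru; rewrite Cr; apply/eqP; rewrite eq_comp.
have nup u p : connect (adj G) r u -> p \notin C -> ~~ connect (adj G) u p.
  by move=> ru; rewrite (inC u ru) inE.
have AT : A \subset T -> \sum_(p | p \notin C) degree G p <= 15 * #|T|.
  move=> /subset_leq_card AT; rewrite sA; apply: leq_trans AT _.
  by rewrite leq_pmull.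
case: (gadget_exists r simpleG).
- move=> [u ru du]; apply: AT; apply/fintype.subsetP => -[p q].
  rewrite inE /= => /andP[pC pq]; apply: (direct u u); first exact: inC.
  by split=> //; [exact: nup|exact: SwitchLeaf].
- move=> [u [w [ru auw du dw]]]; apply: AT; apply/fintype.subsetP => -[p q].
  rewrite inE /= => /andP[pC pq]; apply: (direct u w); first exact: inC.
  by split=> //; [exact: nup|exact: SwitchPair].
move=> [u [w [v [ru good]]]]; have [auw _ [c [cu cs cc vc wc]]] := good.
have uw := good_edge_connect good.
apply: (leq_trans (card_pendant_items simpleG _)).
  by rewrite Cr; exact: closed_comp_set.
rewrite leq_mul2l /=; apply: subset_leq_card; apply/fintype.subsetP => -[p q].
have swapped : switchable G false p q u w -> (p, q) \in T.
  move=> sw; rewrite !inE; apply/asboolP; rewrite (inC u ru).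
  by exists (switch false p q u w G); eexists; exact: StepSwapped.
rewrite [_ \in pendant_items _ _]inE /= => /andP[pC H].
have npu : ~~ connect (adj G) p u by rewrite adj_connect_sym nup.
case/or3P: H => [/andP[pq nb]|/andP[/eqP pqE /eqP dp]|/and3P[pq /eqP dp /eqP dq]].
- rewrite !inE; apply/asboolP; rewrite (inC u ru).
  exists (switch true u w p q G); eexists; apply: StepCut good _.
    by split=> //; [exact: nup|exact: SwitchCut].
  by move: nb; rewrite /is_bridge pq negbK.
- by apply: swapped; split=> //; apply: SwitchLeaf; rewrite ?dp.
- by apply: swapped; split=> //; exact: SwitchPair.
Qed.

(** The tokens are summed over the components: each vertex lies outside k + 1 of the k + 2
    components, and each isolated vertex is a component of its own. *)
Lemma card_tokens k : ncomp G = k.+2 -> k.+1 * weight G <= 60 * #|tokens G|.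
Proof.
move=> kG; rewrite weightE; set s := \sum_v _.
have iso_sub : comp G @: isolated \subset comps G.
  by apply/fintype.subsetP => C /imsetP[v _ ->]; exact: comp_in_comps.
have card_iso : #|comp G @: isolated| = #|isolated|.
  apply: card_in_imset => v z vi zi /eqP; rewrite eq_comp.
  by move=> /(isolated_connect vi).
apply: (@token_arith _ _ _ #|isolated|).
- rewrite -cardsT -(cardsID isolated [set: V]) setTI leq_add2l.
  rewrite -sum1_card big_mkcond /=; apply: leq_sum => v _.
  by rewrite !inE andbT; case: (degree G v).
- by rewrite -ltnS -kG ltnS; exact: leq_imset_card.
- by rewrite -card_iso -kG; exact: subset_leq_card.
have -> : k.+1 * s + #|isolated| * (#|isolated| - 1) =
    \sum_(C in comps G) (\sum_(p | p \notin C) degree G p +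
      (if C \in comp G @: isolated then #|isolated| - 1 else 0)).
  rewrite big_split /=; congr addn.
    rewrite (exchange_big_dep predT) //= /s big_distrr /=.
    apply: eq_bigr => p _; rewrite sum_nat_const; congr muln.
    have <- : #|comps G :\ comp G p| = k.+1.
      have := cardsD1 (comp G p) (comps G).
      by rewrite comp_in_comps -/(ncomp G) kG add1n => -[].
    apply: eq_card => C; rewrite !inE [RHS]unfold_in /= andbC.
    have [CG|//] := boolP (C \in comps G).
    have [r _ ->] := imsetP CG.
    by rewrite inE -eq_comp eq_sym.
  rewrite -big_mkcondr /= (eq_bigl (fun C => C \in comp G @: isolated)).
    by rewrite sum_nat_const card_iso.
  by move=> C /=; apply: andb_idl; exact: (fintype.subsetP iso_sub).
apply: (@leq_trans (\sum_(C in comps G) 15 * #|[set a | (C, a) \in tokens G]|)).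
  by apply: leq_sum => C; exact: tokens_comp.
rewrite -big_distrr /= leq_mul2l /=.
rewrite (eq_bigr (fun C => \sum_(a | (C, a) \in tokens G) 1)); last first.
  by move=> C _; rewrite sum1_card cardsE.
rewrite pair_big_dep /= sum1_card; apply: subset_leq_card.
by apply/fintype.subsetP => -[C a]; rewrite !unfold_in /= => /andP[].
Qed.

End Count.

(** The constant is 60 * 4 * 81: the token bound, the growth of the weight and the code bound. *)
Lemma components_ratio (P : pred {set {set V}}) k :
  (forall G, P G -> simple_graph G) ->
  (forall G b u w x y, P G -> switchable G b u w x y ->
     P (switch b u w x y G)) ->
  k.+1 * #|[set G | P G & ncomp G == k.+2]| <=
  19440 * #|[set G | P G & ncomp G == k.+1]|.
Proof.
move=> Psimple Pswitch.
have stepP G t H d : step G t H d -> exists b u w x y,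
    switchable G b u w x y /\ H = switch b u w x y G.
  case=> [u w p q sw|p q x y sw|u w v p q sw _ _].
  - by exists false, u, w, p, q.
  - by exists false, p, q, x, y.
  - by exists true, u, w, p, q.
have wpos G u : 0 < weight G.
  by rewrite weightE; apply: ltn_addr; apply/card_gt0P; exists u.
apply: (@weighted_double_count _ _ _ _ _ _ tokens codes step weight weight
  k.+1 60 4 81).
- move=> G; rewrite inE => /andP[PG /eqP kG]; split.
    have [C /imsetP[u _ _]] : exists C, C \in comps G.
      by apply/card_gt0P; rewrite -/(ncomp G) kG.
    exact: wpos.
  exact (card_tokens (Psimple G PG) kG).
- by move=> G t _; rewrite inE => /asboolP.
- move=> G t H d; rewrite inE => /andP[PG /eqP kG] st.
  have [b [u [w [x [y [sw HE]]]]]] := stepP _ _ _ _ st.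
  split; [|exact: step_codes st|exact: wpos|].
    rewrite inE HE Pswitch //= -eqSS -kG; apply/eqP.
    by rewrite (ncomp_switch sw).
  by rewrite HE; exact: weight_switch.
- exact: step_inj.
- by move=> H _; exact: card_codes.
Qed.

End Tokens.

(** * Degree bounds and switches within the class *)

Section Class.
Local Open Scope nat_scope.
Local Open Scope set_scope.
Variable V : finType.
Implicit Types (G : {set {set V}}).

Lemma min_degree_le G v : min_degree G <= degree G v.
Proof.
rewrite /min_degree; have := mem_index_enum v.
elim: (index_enum V) => // a s IH; rewrite inE big_cons geq_min.
by case/predU1P => [->|/IH ->]; rewrite ?leqnn ?orbT.
Qed.

(** The conjunct [d <= #|V|] comes from the default of the minimum. *)
Lemma leq_min_degree G d :
  (d <= min_degree G) = (d <= #|V|) && [forall v, d <= degree G v].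
Proof.
apply/idP/andP => [dG|[dV /forallP dG]].
  split; last by apply/forallP => v; apply: leq_trans dG (min_degree_le G v).
  apply: leq_trans dG _; rewrite /min_degree.
  apply: (big_ind (fun m => m <= #|V|)) => // [m n mV _|v _].
    by rewrite geq_min mV.
  exact: max_card.
apply: (big_ind (fun m => d <= m)) => // m n dm dn.
by rewrite leq_min dm.
Qed.

Lemma min_degree_attained G d (v0 : V) : min_degree G <= d ->
  exists v, degree G v <= d.
Proof.
move=> Gd; apply/existsP; apply: contraTT Gd; rewrite negb_exists -ltnNge.
move=> /forallP H; have {}H v : d < degree G v by rewrite ltnNge; exact: H.
rewrite leq_min_degree; apply/andP; split; last exact/forallP.
by apply: leq_trans (H v0) (max_card _).
Qed.

(** The vertex [v0] excludes the empty graph, which is connected but has no component. *)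
Lemma connected_graph_ncomp G (v0 : V) : connected_graph G = (ncomp G == 1).
Proof.
apply/idP/cards1P => [/forallP cG|[C CG]].
  exists (comp G v0); apply/setP => C; rewrite inE; apply/imsetP/eqP.
    by case=> v _ ->; apply/eqP; rewrite eq_comp; exact: (forallP (cG v)).
  by move=> ->; exists v0.
apply/forallP => u; apply/forallP => v; rewrite -eq_comp.
have : comp G u \in comps G by exact: comp_in_comps.
have : comp G v \in comps G by exact: comp_in_comps.
by rewrite CG !inE => /eqP-> /eqP->.
Qed.

End Class.

Section ClassSwitch.
Local Open Scope nat_scope.
Variable R : realType.

Lemma planar_graphs_simple n d1 D2 G :
  G \in planar_graphs R n d1 5 0 D2 -> simple_graph G.
Proof. by rewrite inE => /and4P[]. Qed.

(** Degrees never fall, and they rise at most to 3: this respects [D2] by hypothesis, and a vertex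
    of degree at most 5 keeps that property. *)
Lemma planar_graphs_switch n d1 D2 (G : {set {set 'I_n}}) b u w x y : 3 <= D2 ->
  G \in planar_graphs R n d1 5 0 D2 -> switchable G b u w x y ->
  switch b u w x y G \in planar_graphs R n d1 5 0 D2.
Proof.
move=> D3; rewrite !inE => /and4P[_ /asboolP Gp /andP[dG G5] /andP[_ GD]] sw.
have deg z := switch_degree sw z.
apply/and4P; split.
- exact: switch_simple sw.
- by apply/asboolP; exact: switch_planar.
- apply/andP; split.
    move: dG; rewrite !leq_min_degree => /andP[-> /forallP dG] /=.
    apply/forallP => v; apply: leq_trans (dG v) _.
    by case/andP: (deg v).
  have [v dv] := min_degree_attained u G5.
  apply: leq_trans (min_degree_le _ v) _.
  have /andP[_ H] := deg v; apply: leq_trans H _.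
  by rewrite geq_max dv.
- apply/bigmax_leqP => v _; have /andP[_ H] := deg v; apply: leq_trans H _.
  rewrite geq_max D3 /=; apply: leq_trans GD.
  exact: (leq_bigmax v).
Qed.

End ClassSwitch.

(** * Exponential bound and conclusion *)

Lemma expR_partial_sum (R : realType) (x : R) n : 0 <= x ->
  \sum_(0 <= k < n) x ^+ k / k`!%:R <= expR x.
Proof.
move=> x0; rewrite /expR.
apply: (@nondecreasing_cvgn_le R (series (exp_coeff x))); last first.
  exact: is_cvg_series_exp_coeff.
apply/nondecreasing_seqP => k; rewrite /series /= big_nat_recr //= lerDl.
by rewrite divr_ge0 // exprn_ge0.
Qed.

(** Iterating the ratio m / (j + 1) produces the terms of the exponential series. *)
Lemma factorial_decay (R : realType) (N : nat -> nat) (m k : nat) :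
  (forall j, j.+1 * N j.+1 <= m * N j)%N ->
  (N k)%:R <= m%:R ^+ k / k`!%:R * (N 0%N)%:R :> R.
Proof.
move=> Nstep; elim: k => [|k IH]; first by rewrite expr0 fact0 divr1 mul1r.
have k0 : (0 : R) < k.+1%:R by rewrite ltr0n.
rewrite -(ler_pM2l k0) -natrM.
apply: (@le_trans _ _ (m%:R * (N k)%:R)); first by rewrite -natrM ler_nat Nstep.
apply: (@le_trans _ _ (m%:R * (m%:R ^+ k / k`!%:R * (N 0%N)%:R))).
  by rewrite ler_wpM2l // ler0n.
have -> : m%:R ^+ k.+1 / k.+1`!%:R = k.+1%:R^-1 * (m%:R * (m%:R ^+ k / k`!%:R)) :> R.
  by rewrite factS natrM exprS invfM mulrCA !mulrA.
by rewrite !mulrA divff ?gt_eqF // mul1r.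
Qed.

Theorem theorem13p2 (R : realType) :
  exists c : R, 0 < c /\
    forall r d1 D2 : nat,
      (3 <= D2)%N ->
      planar_graphs R r d1 5 0 D2 <> set0 ->
      c <
        finite_uniform_pr R (planar_graphs R r d1 5 0 D2) (@connected_graph 'I_r).
Proof.
(* From here on the ratio only has to be absolute, so its value is abstracted. *)
have := @components_ratio; move: 19440%N => m ratio.
pose M : R := m%:R; have M0 : 0 <= M by exact: ler0n.
have eM : 1 <= expR M by rewrite -expR0 ler_expR.
(* The count yields a probability of at least exp(-M); the factor 2 makes the inequality strict. *)
exists (2 * expR M)^-1; split; first by rewrite invr_gt0 mulr_gt0 // expR_gt0.
move=> r d1 D2 D3; set A := planar_graphs R r d1 5 0 D2 => A0.
have cA : (0 < #|A|)%N by rewrite card_gt0; exact/eqP.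
rewrite /finite_uniform_pr.
(* Without vertices every graph is connected and the probability is 1. *)
case: r => [|n] in A A0 cA *.
  have -> : [set x in A | connected_graph x]%SET = A.
    apply/setP => G; rewrite inE andb_idr // => _.
    by apply/forallP => -[].
  rewrite divff ?pnatr_eq0 -?lt0n // invf_lt1 ?mulr_gt0 ?expR_gt0 //.
  by lra.
(* The index is shifted: [N k] counts the graphs with k + 1 components, so [N 0] counts the
   connected ones. *)
pose N k := #|[set G | (G \in A) && (ncomp G == k.+1)]%SET|.
have Nstep k : (k.+1 * N k.+1 <= m * N k)%N.
  apply: (@ratio _ (mem A)) => [G|G b u w x y].
    exact: planar_graphs_simple.
  exact: planar_graphs_switch.
have Asum : #|A| = (\sum_(0 <= k < n.+1) N k)%N.
  (* The number of components lies between 1 and the number of vertices, so its predecessor is a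
     valid index. *)
  pose f (G : {set {set 'I_n.+1}}) : 'I_n.+1 := inord (ncomp G).-1.
  rewrite -sum1_card (partition_big f predT) //= big_mkord.
  apply: eq_bigr => k _; rewrite sum1dep_card; apply: eq_card => G.
  rewrite !inE; congr andb.
  have G0 : (0 < ncomp G)%N.
    by apply/card_gt0P; exists (comp G ord0); exact: comp_in_comps.
  have Gn : (ncomp G <= n.+1)%N.
    by rewrite -[X in (_ <= X)%N]card_ord; exact: leq_imset_card.
  by rewrite -val_eqE /= inordK ?prednK // -eqSS prednK.
(* The decay, summed over all numbers of components, is a partial sum of the exponential series
   times the number of connected graphs. *)
have AN : #|A|%:R <= expR M * (N 0%N)%:R.
  rewrite Asum natr_sum; apply: (@le_trans _ _
    (\sum_(0 <= k < n.+1) M ^+ k / k`!%:R * (N 0%N)%:R)).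
    by apply: ler_sum => k _; exact: factorial_decay.
  by rewrite -mulr_suml ler_wpM2r // expR_partial_sum.
have -> : [set x in A | connected_graph x]%SET =
    [set G | (G \in A) && (ncomp G == 1%N)]%SET.
  by apply/setP => G; rewrite !inE (connected_graph_ncomp G ord0).
rewrite -/(N 0%N) ltr_pdivlMr ?ltr0n // mulrC ltr_pdivrMr ?mulr_gt0 ?expR_gt0 //.
have A0' : (0 : R) < #|A|%:R by rewrite ltr0n.
by rewrite mulrCA; lra.
Qed.
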